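(* Let $\mathbb{F}_q$ be a finite field of odd characteristic and let $R$ be a primitive irreducible character of $\mathrm{SL}_2(\mathbb{F}_q[\varepsilon])$, where $\varepsilon^2=0$. Then $R$ is a semisimple orbit character if and only if $\mathrm{Sh}_G(R)=R$.
   Context: Let $\mathbb{F}_q[\varepsilon]=\mathbb{F}_q[[\pi]]/\pi^2$ and let $G$ be the connected algebraic group over $\overline{\mathbb{F}}_q$ with $G(\overline{\mathbb{F}}_q)=\mathrm{SL}_2(\overline{\mathbb{F}}_q[\varepsilon])$, with Frobenius endomorphism $F$ raising coefficients to the $q$-th power, so that $G^F=\mathrm{SL}_2(\mathbb{F}_q[\varepsilon])$. Primitive: an irreducible character of $G^F$ is primitive if it does not factor through the reduction map $\mathrm{SL}_2(\mathbb{F}_q[\varepsilon])\to\mathrm{SL}_2(\mathbb{F}_q)$, $\varepsilon\mapsto0$. Twisting operator: by Lang--Steinberg every $g\in G^F$ can be written $g=h^{-1}F(h)$ with $h\in G$; then $F(h)h^{-1}\in G^F$, and $n_F([g]_{G^F}):=[F(h)h^{-1}]_{G^F}$ is a well-defined permutation of the conjugacy classes of $G^F$. For a class function $f$ on $G^F$, $\mathrm{Sh}_G(f):=f\circ n_F$. Orbits: let $\mathfrak{g}=\mathfrak{sl}_2$ over $\overline{\mathbb{F}}_q$, with $\mathfrak{g}^F=\mathfrak{sl}_2(\mathbb{F}_q)$. Fix a non-degenerate $\mathrm{SL}_2$-invariant bilinear form $\mu\colon\mathfrak{g}\times\mathfrak{g}\to\overline{\mathbb{F}}_q$ defined over $\mathbb{F}_q$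 and a non-trivial character $\phi$ of the additive group $\mathbb{F}_q$. The kernel $(G^1)^F$ of $\mathrm{SL}_2(\mathbb{F}_q[\varepsilon])\to\mathrm{SL}_2(\mathbb{F}_q)$ is identified with the additive group $\mathfrak{sl}_2(\mathbb{F}_q)$ via $1+\varepsilon X\leftrightarrow X$. For an irreducible character $\sigma$ of $G^F$, by Clifford's theorem the irreducible constituents of $\sigma|_{(G^1)^F}$ form a single $\mathrm{SL}_2(\mathbb{F}_q)$-orbit of characters of $\mathfrak{sl}_2(\mathbb{F}_q)$; via the bijection $X\mapsto\phi(\mu(X,-))$ this corresponds to an adjoint $\mathrm{SL}_2(\mathbb{F}_q)$-orbit $\Omega'(\sigma)$ in $\mathfrak{sl}_2(\mathbb{F}_q)$, called the orbit of $\sigma$. The character $\sigma$ is a semisimple orbit character if $\Omega'(\sigma)$ consists of semisimple elements. *)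

(* Defs.v *)
From HB Require Import structures.
From mathcomp Require Import all_boot all_order all_algebra all_fingroup.
From mathcomp Require Import all_solvable all_field all_character.
From mathcomp Require Import ring boolp.

Set Implicit Arguments.
Unset Strict Implicit.
Unset Printing Implicit Defensive.

Import GRing.Theory.
Local Open Scope ring_scope.

(* Dual numbers, with 'qX in the role of epsilon. *)
Notation "R '[eps]'" := {poly %/ ('X^2 : {poly R})}
  (at level 2, left associativity, format "R [eps]") : type_scope.

Section DualNumbers.
Variable R : comNzRingType.
Implicit Types (p q : {poly R}) (a b : R[eps]).

Lemma mk_monic_X2 : mk_monic ('X^2 : {poly R}) = 'X^2.
Proof. exact: mk_monic_Xn. Qed.

Lemma coef_in_qpoly_X2 p i :
  (in_qpoly 'X^2 p)`_i = if (i < 2)%N then p`_i else 0.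
Proof.
rewrite -coef_take_poly /= mk_monic_X2 -{1}(poly_take_drop 2 p) addrC.
rewrite Pdiv.RingMonic.rmodp_addl_mul_small ?monicXn //.
by rewrite size_polyXn ltnS size_take_poly.
Qed.

Lemma coef_dual_ge2 a i : (2 <= i)%N -> a`_i = 0.
Proof. by move=> i2; rewrite big_coef_npoly // mk_monic_X2 size_polyXn. Qed.

Lemma dualP a b : a`_0 = b`_0 -> a`_1 = b`_1 -> a = b.
Proof.
move=> e0 e1; apply/npolyP => -[|[|i]] //.
by rewrite !coef_dual_ge2.
Qed.

Lemma coef0_dualM a b : (a * b)`_0 = a`_0 * b`_0.
Proof.
have -> : a * b = in_qpoly 'X^2 ((a : {poly R}) * (b : {poly R})).
  by apply: val_inj.
by rewrite coef_in_qpoly_X2 coefM big_ord1.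
Qed.

Lemma coef1_dualM a b : (a * b)`_1 = a`_0 * b`_1 + a`_1 * b`_0.
Proof.
have -> : a * b = in_qpoly 'X^2 ((a : {poly R}) * (b : {poly R})).
  by apply: val_inj.
by rewrite coef_in_qpoly_X2 coefM big_ord_recl big_ord1.
Qed.

Lemma coef_dual1 i : (1 : R[eps])`_i = (i == 0)%:R.
Proof. by rewrite (_ : (1 : R[eps]) = 1%:P :> {poly R}) // coefC; case: i. Qed.

Lemma coef_dualB a b i : (a - b)`_i = a`_i - b`_i.
Proof. by rewrite /= coefB. Qed.

Definition eps0 a : R := a`_0.

Lemma eps0_is_zmod_morphism : zmod_morphism eps0.
Proof. by move=> a b; rewrite /eps0 coef_dualB. Qed.
Lemma eps0_is_monoid_morphism : monoid_morphism eps0.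
Proof. by split=> [|a b]; rewrite /eps0 ?coef_dual1 ?coef0_dualM. Qed.
HB.instance Definition _ :=
  GRing.isZmodMorphism.Build R[eps] R eps0 eps0_is_zmod_morphism.
HB.instance Definition _ :=
  GRing.isMonoidMorphism.Build R[eps] R eps0 eps0_is_monoid_morphism.

End DualNumbers.

Section DualMap.
Variables (R S : comNzRingType) (f : {rmorphism R -> S}).

Definition dual_map (a : R[eps]) : S[eps] := in_qpoly 'X^2 (map_poly f a).

Lemma coef_dual_map a i : (dual_map a)`_i = f a`_i.
Proof.
rewrite coef_in_qpoly_X2 coef_map; case: ltnP => // i2.
by rewrite coef_dual_ge2 ?rmorph0.
Qed.

Lemma dual_map_is_zmod_morphism : zmod_morphism dual_map.
Proof.
by move=> a b; apply: dualP; rewrite coef_dualB !coef_dual_map coef_dualB rmorphB.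
Qed.
Lemma dual_map_is_monoid_morphism : monoid_morphism dual_map.
Proof.
split=> [|a b]; apply: dualP; rewrite ?(coef0_dualM, coef1_dualM) !coef_dual_map.
- by rewrite !coef_dual1 rmorph1.
- by rewrite !coef_dual1 rmorph0.
- by rewrite coef0_dualM rmorphM.
- by rewrite coef1_dualM rmorphD !rmorphM.
Qed.
HB.instance Definition _ := GRing.isZmodMorphism.Build R[eps] S[eps] dual_map
  dual_map_is_zmod_morphism.
HB.instance Definition _ := GRing.isMonoidMorphism.Build R[eps] S[eps] dual_map
  dual_map_is_monoid_morphism.
End DualMap.

Record SL2 (R : comNzRingType) := MkSL2 {
  SL2val :> 'M[R]_2;
  SL2_det : \det SL2val == 1 }.

HB.instance Definition _ (R : comNzRingType) := [isSub for @SL2val R].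
HB.instance Definition _ (R : comNzRingType) := [Choice of SL2 R by <:].
HB.instance Definition _ (R : finComNzRingType) := [Finite of SL2 R by <:].

Section SL2Group.
Variable R : comNzRingType.
Implicit Types g h : SL2 R.

Lemma SL2_one_subproof : \det (1%:M : 'M[R]_2) == 1.
Proof. by rewrite det1. Qed.
Lemma SL2_mul_subproof g h : \det (g *m h) == 1.
Proof. by rewrite det_mulmx (eqP (SL2_det g)) (eqP (SL2_det h)) mulr1. Qed.
Lemma SL2_inv_subproof g : \det (\adj g) == 1.
Proof.
have := congr1 determinant (mul_mx_adj g).
by rewrite det_mulmx (eqP (SL2_det g)) mul1r det1 => ->.
Qed.

Definition SL2_one := MkSL2 SL2_one_subproof.
Definition SL2_mul g h := MkSL2 (SL2_mul_subproof g h).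
Definition SL2_inv g := MkSL2 (SL2_inv_subproof g).

Lemma SL2_mulA : associative SL2_mul.
Proof. by move=> a b c; apply: val_inj; rewrite /= mulmxA. Qed.
Lemma SL2_mul1 : left_id SL2_one SL2_mul.
Proof. by move=> a; apply: val_inj; rewrite /= mul1mx. Qed.
Lemma SL2_mulr1 : right_id SL2_one SL2_mul.
Proof. by move=> a; apply: val_inj; rewrite /= mulmx1. Qed.
Lemma SL2_mulV : left_inverse SL2_one SL2_inv SL2_mul.
Proof. by move=> a; apply: val_inj; rewrite /= mul_adj_mx (eqP (SL2_det a)). Qed.
Lemma SL2_mulrV : right_inverse SL2_one SL2_inv SL2_mul.
Proof. by move=> a; apply: val_inj; rewrite /= mul_mx_adj (eqP (SL2_det a)). Qed.

HB.instance Definition _ := isGroup.Build (SL2 R)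
  SL2_mulA SL2_mul1 SL2_mulr1 SL2_mulV SL2_mulrV.
End SL2Group.

Section SL2Map.
Variables (R S : comNzRingType) (f : {rmorphism R -> S}).

Lemma SL2map_subproof (g : SL2 R) : \det (map_mx f g) == 1.
Proof. by rewrite det_map_mx (eqP (SL2_det g)) rmorph1. Qed.
Definition SL2map (g : SL2 R) : SL2 S := MkSL2 (SL2map_subproof g).

Lemma SL2mapM : {morph SL2map : g h / (g * h)%g}.
Proof. by move=> g h; apply: val_inj; rewrite /= map_mxM. Qed.
Lemma SL2map1 : SL2map 1%g = 1%g.
Proof. by apply: val_inj; rewrite /= map_mx1. Qed.
End SL2Map.


HB.instance Definition _ (R : finComNzRingType) := Finite.on (SL2 R).

Section SpecialLinearLieAlgebra.
Variable R : comNzRingType.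

Definition traceless : {pred 'M[R]_2} := fun X => \tr X == 0.

Lemma traceless_submod_closed : submod_closed traceless.
Proof.
split=> [|a X Y]; rewrite /in_mem /= /traceless ?mxtrace0 // => /eqP X0 /eqP Y0.
by rewrite mxtraceD mxtraceZ X0 Y0 mulr0 addr0.
Qed.
HB.instance Definition _ :=
  GRing.isSubmodClosed.Build R 'M[R]_2 traceless traceless_submod_closed.

Record sl2 := MkSl2 { sl2val :> 'M[R]_2; sl2_tr : sl2val \in traceless }.
HB.instance Definition _ := [isSub for sl2val].
HB.instance Definition _ := [Choice of sl2 by <:].
HB.instance Definition _ := [SubChoice_isSubLmodule of sl2 by <:].

Lemma Ad_subproof (g : SL2 R) (X : sl2) : g *m X *m (g^-1)%g \in traceless.
Proof.
rewrite /in_mem /= /traceless mxtrace_mulC mulmxA.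
have -> : (g^-1)%g *m g = 1%:M := congr1 (@SL2val R) (mulVg g).
by rewrite mul1mx; apply: sl2_tr.
Qed.
Definition Ad (g : SL2 R) (X : sl2) : sl2 := MkSl2 (Ad_subproof g X).

Definition one_plus_eps_mx (X : 'M[R]_2) : 'M[R[eps]]_2 :=
  1%:M + 'qX *: map_mx (qpolyC 'X^2) X.

Lemma one_plus_eps_subproof (X : sl2) : \det (one_plus_eps_mx X) == 1.
Proof.
have /eqP := sl2_tr X; rewrite /mxtrace big_ord_recl big_ord1 => trX.
rewrite (expand_det_row _ 0) big_ord_recl big_ord1 /cofactor !det_mx11 !mxE /=.
have ee : 'qX * 'qX = 0 :> R[eps].
  rewrite -in_qpolyM; apply: dualP; rewrite coef_in_qpoly_X2 /= coef0 -expr2 coefXn //.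
have -> : X (lift 0 0) (lift ord0 0) = - X 0 ord0.
  by apply/eqP; rewrite -addr_eq0 addrC trX.
rewrite qpolyCN.
move: 'qX ee (qpolyC _ _) (qpolyC _ _) (qpolyC _ _) => e ee c b a.
rewrite -[X in _ == X](_ : 1 - e * e * (a * a + b * c) = 1).
  by apply/eqP; rewrite /bump /=; ring.
by rewrite ee mul0r subr0.
Qed.
Definition one_plus_eps (X : sl2) : SL2 R[eps] :=
  MkSL2 (one_plus_eps_subproof X).
End SpecialLinearLieAlgebra.

HB.instance Definition _ (R : finComNzRingType) := [Finite of sl2 R by <:].

Section Sl2Map.
Variables (R S : comNzRingType) (f : {rmorphism R -> S}).

Lemma sl2map_subproof (X : sl2 R) : map_mx f X \in @traceless S.
Proof. by rewrite /in_mem /= /traceless trace_map_mx (eqP (sl2_tr X)) rmorph0. Qed.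
Definition sl2map (X : sl2 R) : sl2 S := MkSl2 (sl2map_subproof X).
End Sl2Map.

Section Frobenius.
Variables (Fq : finFieldType) (k : fieldType) (iota : {rmorphism Fq -> k}).

(* The q-power map, q = #|Fq|; the embedding only serves to make it additive,
   by fixing the characteristic of k. *)
Definition frob of {rmorphism Fq -> k} := fun x : k => x ^+ #|Fq|.

Lemma pchar_nat_card : [pchar k].-nat #|Fq|.
Proof.
have [p p_pr pFq] := finPcharP Fq.
rewrite (eq_pnat _ (pcharf_eq (rmorph_pchar iota pFq))).
by have := abelem_pgroup (fin_ring_pchar_abelem pFq); rewrite /pgroup cardsT.
Qed.

Lemma frob_is_zmod_morphism : zmod_morphism (frob iota).
Proof. by move=> x y; rewrite /frob exprDn_pchar ?exprNn_pchar ?pchar_nat_card. Qed.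
Lemma frob_is_monoid_morphism : monoid_morphism (frob iota).
Proof. by split=> [|x y]; rewrite /frob ?expr1n ?exprMn. Qed.
HB.instance Definition _ :=
  GRing.isZmodMorphism.Build k k (frob iota) frob_is_zmod_morphism.
HB.instance Definition _ :=
  GRing.isMonoidMorphism.Build k k (frob iota) frob_is_monoid_morphism.
End Frobenius.

Section TwistingOperator.
Variables (Fq : finFieldType) (k : fieldType) (iota : {rmorphism Fq -> k}).

Local Notation G := (SL2 k[eps]).
(* The F-fixed points of G, identified with SL2 Fq[eps] through embed. *)
Local Notation GF := (SL2 Fq[eps]).

Definition FrobG : G -> G := SL2map (dual_map (frob iota)).
Definition embed : GF -> G := SL2map (dual_map iota).

(* The image of a class C under [h^-1 F(h)] |-> [F(h) h^-1]: the set of all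
   values F(h) h^-1 over h in G with h^-1 F(h) in C. By Lang-Steinberg this is
   a single conjugacy class of G^F; in particular it is not empty. *)
Definition n_F (C : {set GF}) : {set GF} :=
  [set g' : GF | `[< exists2 h : G,
     exists2 g, g \in C & embed g = (h^-1 * FrobG h)%g &
     embed g' = (FrobG h * h^-1)%g >]].

(* f \o n_F: the value of f at any element of the class n_F [x]. *)
Lemma Sh_G_subproof (f : 'CF([set: GF])) :
  is_class_fun <<[set: GF]>>%g [ffun x => f (repr (n_F (x ^: [set: GF])%g))].
Proof.
rewrite genGid; apply: intro_class_fun => [x y _ Gy | x]; last by rewrite inE.
by rewrite classGidl.
Qed.
Definition Sh_G (f : 'CF([set: GF])) : 'CF([set: GF]) := Cfun 0 (Sh_G_subproof f).

End TwistingOperator.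

Section Reduction.
Variable Fq : finFieldType.

Definition red : SL2 Fq[eps] -> SL2 Fq := SL2map (@eps0 Fq).
Definition cong_ker : {set SL2 Fq[eps]} := [set g | red g == 1%g].

Lemma cong_ker_group_set : group_set cong_ker.
Proof.
apply/group_setP; split=> [|g h]; rewrite !inE /red ?SL2map1 // SL2mapM.
by move=> /eqP-> /eqP->; rewrite mulg1.
Qed.
Canonical cong_ker_group := Group cong_ker_group_set.

Definition primitive_char (chi : 'CF([set: SL2 Fq[eps]])) : Prop :=
  ~ exists psi : 'CF([set: SL2 Fq]), forall g, chi g = psi (red g).
End Reduction.

Section Orbits.
Variables (Fq : finFieldType) (muq : sl2 Fq -> sl2 Fq -> Fq).
Variable phi : 'CF([set: Fq]).

(* The X whose character 1 + eps Y |-> phi (muq X Y) is a constituent of the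
   restriction of sigma to the kernel of reduction. *)
Definition orbit_of (sigma : 'CF([set: SL2 Fq[eps]])) : {set sl2 Fq} :=
  [set X | [exists j in irr_constt ('Res[cong_ker_group Fq] sigma),
             forall Y, 'chi_j (one_plus_eps Y) == phi (muq X Y)]].

(* Semisimple = diagonalizable over the algebraically closed field k. *)
Definition semisimple_orbit_char (k : fieldType) (iota : {rmorphism Fq -> k})
    (sigma : 'CF([set: SL2 Fq[eps]])) : Prop :=
  forall X, X \in orbit_of sigma -> diagonalizable (map_mx iota X).
End Orbits.

Section BilinearForms.
Variable k : fieldType.

Definition nondegenerate_form (mu : sl2 k -> sl2 k -> k) : Prop :=
  (forall X, (forall Y, mu X Y = 0) -> X = 0) /\
  (forall Y, (forall X, mu X Y = 0) -> Y = 0).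

Definition SL2_invariant (mu : sl2 k -> sl2 k -> k) : Prop :=
  forall g X Y, mu (Ad g X) (Ad g Y) = mu X Y.

(* mu is the base change of the form muq on sl2 Fq. *)
Definition defined_over (Fq : finFieldType) (iota : {rmorphism Fq -> k})
    (mu : sl2 k -> sl2 k -> k) (muq : sl2 Fq -> sl2 Fq -> Fq) : Prop :=
  forall X Y, mu (sl2map iota X) (sl2map iota Y) = iota (muq X Y).
End BilinearForms.

(* Main.v *)
(* If F(F(a)) - tr(g) F(a) + a = 0 in k[eps], then h = a - F(a) g commutes with
   g and satisfies F(h) = h g; after scaling, det h is a constant d of Fq, which
   depends only on the trace of g mod eps. Hence n_F maps the class of g to that
   of its conjugate by diag(d^-1, 1), and d is not a square if the trace is -2.

   If X lies in the orbit of R and det X <> 0, then R is induced from the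
   stabilizer of X, whence R is invariant under conjugation by the centralizer of
   X in GL2(Fq). The determinant maps this centralizer onto the units of Fq, so R
   is invariant under GL2(Fq) and Sh R = R. If X is nilpotent and nonzero, then
   Sh R = R, evaluated at - (1 + eps Y), says that the orbit of X is stable under
   some diag(d, 1) with d not a square; this is absurd because the centralizer of
   X in GL2(Fq) has only square determinants. *)

Require Import Defs.
From mathcomp Require Import all_boot all_order all_algebra all_fingroup.
From mathcomp Require Import all_solvable all_field all_character.
From mathcomp Require Import ring boolp.
Import Order.TTheory GRing.Theory Num.Theory.
Local Open Scope ring_scope.

Set Implicit Arguments.
Unset Strict Implicit.
Unset Printing Implicit Defensive.

(** * Matrices of size two and dual numbers *)

Lemma sum_ord2 (V : nmodType) (F : 'I_2 -> V) : \sum_i F i = F 0 + F 1.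
Proof.
by rewrite big_ord_recl big_ord1; congr (F _ + F _); apply: val_inj.
Qed.

Section TwoByTwo.
Variable R : comNzRingType.
Implicit Types A B : 'M[R]_2.

Lemma matrix2P A B : A 0 0 = B 0 0 -> A 0 1 = B 0 1 -> A 1 0 = B 1 0 ->
  A 1 1 = B 1 1 -> A = B.
Proof.
move=> e00 e01 e10 e11; apply/matrixP => -[[|[|//]] i2] [[|[|//]] j2].
- by move: e00; congr (A _ _ = B _ _); apply: val_inj.
- by move: e01; congr (A _ _ = B _ _); apply: val_inj.
- by move: e10; congr (A _ _ = B _ _); apply: val_inj.
- by move: e11; congr (A _ _ = B _ _); apply: val_inj.
Qed.

Lemma det_mx22 A : \det A = A 0 0 * A 1 1 - A 0 1 * A 1 0.
Proof.
rewrite (expand_det_row _ 0) sum_ord2 /cofactor !det_mx11 !mxE.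
have -> : lift 1 0 = 0 :> 'I_2 by apply: val_inj.
have -> : lift 0 0 = 1 :> 'I_2 by apply: val_inj.
by rewrite /= expr0 mul1r (_ : 0 + 1 %% 2 = 1)%N // expr1 mulN1r mulrN.
Qed.

Lemma mxtrace22 A : \tr A = A 0 0 + A 1 1.
Proof. exact: sum_ord2. Qed.

Lemma mulmx22E A B i j : (A *m B) i j = A i 0 * B 0 j + A i 1 * B 1 j.
Proof. by rewrite mxE sum_ord2. Qed.

Lemma Cayley_Hamilton22 A : A *m A = \tr A *: A - (\det A)%:M.
Proof.
by apply: matrix2P; rewrite mulmx22E !mxE mxtrace22 det_mx22 /=; ring.
Qed.

Lemma det_scalar_add22 a b A :
  \det (a%:M + b *: A) = a ^+ 2 + a * b * \tr A + b ^+ 2 * \det A.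
Proof. by rewrite mxtrace22 !det_mx22 !mxE /=; ring. Qed.

End TwoByTwo.

Section DualNumberExtras.
Variable R : comNzRingType.

Definition dualn (a b : R) : R[eps] := in_qpoly 'X^2 (a%:P + b *: 'X).

Lemma coef0_dualn a b : (dualn a b)`_0 = a.
Proof. by rewrite coef_in_qpoly_X2 coefD coefC coefZ coefX mulr0 addr0. Qed.

Lemma coef1_dualn a b : (dualn a b)`_1 = b.
Proof. by rewrite coef_in_qpoly_X2 coefD coefC coefZ coefX mulr1 add0r. Qed.

Lemma coef0_const (a : R) : (qpolyC 'X^2 a)`_0 = a.
Proof. by rewrite qpolyCE coefC. Qed.

Lemma coef1_const (a : R) : (qpolyC 'X^2 a)`_1 = 0.
Proof. by rewrite qpolyCE coefC. Qed.

Lemma coef_dualD (a b : R[eps]) i : (a + b)`_i = a`_i + b`_i.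
Proof. by rewrite /= coefD. Qed.

Lemma coef_dualN (a : R[eps]) i : (- a)`_i = - a`_i.
Proof. by rewrite -sub0r coef_dualB coef0 sub0r. Qed.
End DualNumberExtras.

Definition coef_dualE := (coef0_dualM, coef1_dualM, coef_dualD, coef_dualN,
  coef0_dualn, coef1_dualn, coef0_const, coef1_const, coef_dual1, coef_dual_map).

Lemma dual_map_const (R S : comNzRingType) (f : {rmorphism R -> S}) (a : R) :
  dual_map f (qpolyC 'X^2 a) = qpolyC 'X^2 (f a).
Proof. by apply: dualP; rewrite coef_dual_map !coef_dualE ?rmorph0. Qed.

(** * An explicit Lang-Steinberg theorem *)

Section LangSteinberg.
Variables (Fq : finFieldType) (k : closedFieldType) (iota : {rmorphism Fq -> k}).
Local Notation q := #|Fq|.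
Local Notation Fr := (dual_map (frob iota)).
Local Notation incl := (dual_map iota).

Lemma frobE x : frob iota x = x ^+ q. Proof. by []. Qed.

Lemma frob_iota x : frob iota (iota x) = iota x.
Proof. by rewrite frobE -rmorphXn expf_card. Qed.

Lemma Frob_incl a : Fr (incl a) = incl a.
Proof. by apply: dualP; rewrite !coef_dual_map; apply: frob_iota. Qed.

Lemma incl_inj : injective incl.
Proof.
move=> a b ab; have e i : iota a`_i = iota b`_i by rewrite -!coef_dual_map ab.
by apply: dualP; apply: (fmorph_inj iota); apply: e.
Qed.

(** Fixed points of the q-power map are roots of X^q - X, which is the product of the X - y over y
    in [Fq]. *)
Lemma frob_fixed x : frob iota x = x -> exists y, iota y = x.
Proof.
rewrite frobE => fx.
have : root (map_poly iota ('X^q - 'X)) x.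
  by rewrite rmorphB /= map_polyXn map_polyX rootE !hornerE fx subrr.
rewrite finField_genPoly rmorph_prod /=.
rewrite rootE horner_prod => /prodf_eq0[y _].
by rewrite rmorphB /= map_polyX map_polyC !hornerE subr_eq0 => /eqP; exists y.
Qed.

Lemma Frob_fixed a : Fr a = a -> exists b, incl b = a.
Proof.
move=> Fa; have fixi i : frob iota a`_i = a`_i by rewrite -coef_dual_map Fa.
have [b0 eb0] := frob_fixed (fixi 0%N); have [b1 eb1] := frob_fixed (fixi 1%N).
by exists (dualn b0 b1); apply: dualP; rewrite !coef_dualE.
Qed.

Lemma embed_inj : injective (embed iota).
Proof.
move=> g h gh; apply: val_inj; apply/matrixP => i j; apply: incl_inj.
by have := congr1 (fun m : SL2 _ => m i j) gh; rewrite /= !mxE.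
Qed.

Lemma FrobG_embed g : FrobG iota (embed iota g) = embed iota g.
Proof. by apply: val_inj; apply/matrixP => i j; rewrite !mxE; apply: Frob_incl. Qed.

Lemma embedM : {morph embed iota : x y / (x * y)%g}.
Proof. exact: SL2mapM. Qed.

Lemma FrobGM : {morph FrobG iota : x y / (x * y)%g}.
Proof. exact: SL2mapM. Qed.

Lemma embedV x : embed iota x^-1%g = ((embed iota x)^-1)%g.
Proof. by apply: (mulgI (embed iota x)); rewrite -embedM !mulgV /embed SL2map1. Qed.

Lemma FrobGV x : FrobG iota x^-1%g = ((FrobG iota x)^-1)%g.
Proof. by apply: (mulgI (FrobG iota x)); rewrite -FrobGM !mulgV /FrobG SL2map1. Qed.

Lemma FrobG_fixed h : FrobG iota h = h -> exists g, embed iota g = h.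
Proof.
move=> Fh.
have /choice[m mE] (ij : 'I_2 * 'I_2) : exists b, incl b = h ij.1 ij.2.
  by apply: Frob_fixed; rewrite -{2}Fh mxE.
pose M : 'M[Fq[eps]]_2 := \matrix_(i, j) m (i, j).
have MhE : map_mx incl M = h by apply/matrixP => i j; rewrite !mxE mE.
have detM : \det M == 1.
  apply/eqP/incl_inj; rewrite -det_map_mx MhE rmorph1; exact/eqP/SL2_det.
by exists (MkSL2 detM); apply: val_inj.
Qed.

(* Dividing by the scalar a, the equation becomes z^(q+1) - t z + 1 = 0 for
   z = a^(q-1); it is separable, so it has at least three roots, one of which is
   not among the two roots of z^2 - t z + 1. *)
Lemma lang_root (t : k) : exists a : k,
  frob iota (frob iota a) - t * frob iota a + a = 0 /\
  a ^+ 2 - t * a * frob iota a + frob iota a ^+ 2 != 0.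
Proof.
have q1 : (1 < q)%N by apply: finNzRing_gt1.
have q0 : q%:R = 0 :> k.
  have := @expg_cardG Fq [set: Fq]%G 1%R (in_setT _).
  rewrite FinRing.zmodXgE cardsT FinRing.zmod1gE -(rmorph_nat iota) => ->.
  exact: rmorph0.
pose P : {poly k} := 'X^(q.+1) + ((- t) *: 'X + 1).
pose Q : {poly k} := 'X^2 + ((- t) *: 'X + 1).
have size_low : (size ((- t) *: 'X + 1 : {poly k})%R <= 2)%N.
  rewrite (leq_trans (size_polyD _ _)) // geq_max size_poly1 andbT.
  by rewrite (leq_trans (size_scale_leq _ _)) // size_polyX.
have sizeP : size P = q.+2.
  by rewrite size_polyDl ?size_polyXn // ltnS (leq_trans size_low) // ltnW.
have sizeQ : size Q = 3 by rewrite size_polyDl ?size_polyXn.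
have sepP : separable_poly P.
  rewrite separable_poly.unlock.
  have dP : P^`() = 'X^q - t%:P.
    rewrite !derivE alg_polyC polyCN addr0 mulrS -mulr_natr -polyC_natr q0.
    by rewrite polyC0 mulr0 addr0.
  (* Since q = 0 in [k], this is a Bezout relation between [P] and its derivative. *)
  have : P - 'X * P^`() = 1.
    by rewrite dP /P exprS scaleNr -mul_polyC; ring.
  move=> e; apply/Bezout_coprimepP; exists (1, - 'X) => /=.
  by rewrite mul1r mulNr e eqpxx.
have [r rP] := closed_field_poly_normal P.
have lP : lead_coef P = 1.
  rewrite /P lead_coefDl ?lead_coefXn // size_polyXn ltnS.
  by rewrite (leq_trans size_low) // ltnW.
rewrite lP scale1r in rP.
have size_r : size r = q.+1.
  by apply/eqP; rewrite -eqSS -(size_prod_XsubC r id) -rP sizeP.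
have uniq_r : uniq r by rewrite -separable_prod_XsubC -rP.
have [z rz Qz] : exists2 z, z \in r & ~~ root Q z.
  apply/hasP; rewrite has_predC; apply/negP => rQ.
  have Q0 : Q != 0 by rewrite -size_poly_eq0 sizeQ.
  have := max_poly_roots Q0 rQ uniq_r.
  by rewrite size_r sizeQ !ltnS leqNgt q1.
have Pz : root P z by rewrite rP root_prod_XsubC.
have {}Pz : z ^+ q.+1 = t * z - 1.
  apply/eqP; rewrite -subr_eq0; move: Pz.
  rewrite rootE !(hornerD, hornerZ, hornerX, hornerXn) -polyC1 hornerC => /eqP e.
  by apply/eqP; rewrite -[RHS]e; ring.
have {}Qz : 1 - t * z + z ^+ 2 != 0.
  apply: contra Qz => /eqP e; rewrite rootE !(hornerD, hornerZ, hornerX, hornerXn).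
  rewrite -polyC1 hornerC; apply/eqP.
  by rewrite -[RHS]e; ring.
have z0 : z != 0.
  apply/eqP => z0; move/eqP: Pz.
  by rewrite z0 expr0n mulr0 sub0r eq_sym oppr_eq0 oner_eq0.
have /closed_rootP[a] : size ('X^(q.-1) - z%:P : {poly k}) != 1%N.
  by rewrite size_XnsubC -(subnKC q1).
rewrite rootE hornerD hornerN hornerXn hornerC subr_eq0 => /eqP az.
have a0 : a != 0.
  apply: contraNneq z0 => a0; rewrite -az a0 expr0n -(subnKC q1) //.
have Fa : frob iota a = a * z by rewrite frobE -az -exprS prednK // ltnW.
exists a; rewrite Fa rmorphM /= Fa frobE; split.
  by rewrite -mulrA -exprS Pz; ring.
(* This norm of [a] is the determinant of a - F(a) g for any g of trace [t] and determinant 1. *)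
have -> : a ^+ 2 - t * a * (a * z) + (a * z) ^+ 2 = a ^+ 2 * (1 - t * z + z ^+ 2).
  by ring.
by rewrite mulf_neq0 // expf_neq0.
Qed.

(** A polynomial of degree q^2 has a root in [k]. This solves the eps-coefficient of F(F(a)) - tr(g)
    F(a) + a = 0 once the constant coefficient is known. *)
Lemma lang_affine_root (t c : k) : exists x : k,
  frob iota (frob iota x) - t * frob iota x + x = c.
Proof.
have q1 : (1 < q)%N by apply: finNzRing_gt1.
have qq : (q < q * q)%N by rewrite -{1}[q]muln1 ltn_pmul2l // ltnW.
have size_low : (size ((- t) *: 'X^q + ('X - c%:P) : {poly k})%R <= q.+1)%N.
  rewrite (leq_trans (size_polyD _ _)) // geq_max size_XsubC ltnS (ltnW q1).
  by rewrite (leq_trans (size_scale_leq _ _)) // size_polyXn.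
have /closed_rootP[x] :
    size ('X^(q * q) + ((- t) *: 'X^q + ('X - c%:P)) : {poly k}) != 1%N.
  rewrite size_polyDl size_polyXn; first by rewrite eqSS -lt0n (leq_ltn_trans _ qq).
  by rewrite ltnS (leq_trans size_low).
rewrite rootE !(hornerD, hornerN, hornerZ, hornerXn, hornerX, hornerC) => /eqP e.
exists x; apply/eqP; rewrite -subr_eq0 -e !frobE exprM; apply/eqP; ring.
Qed.
End LangSteinberg.

Arguments frob : simpl never.
Arguments dual_map : simpl never.

Lemma conj_mulmx (R : pzRingType) n (A B X Y : 'M[R]_n) : B *m A = 1%:M ->
  A *m (X *m Y) *m B = A *m X *m B *m (A *m Y *m B).
Proof.
by move=> BA; rewrite -[RHS]mulmxA [B *m _]mulmxA [B *m _]mulmxA BA mul1mx !mulmxA.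
Qed.

(** With B inverse to A and h = A H, this reads (A X B) h = h X: if H commutes with X and F(h) = h
    X, then F(h) h^-1 = A X A^-1. *)
Lemma conj_mulmx_comm (R : pzRingType) n (A B X H : 'M[R]_n) : B *m A = 1%:M ->
  H *m X = X *m H -> A *m X *m B *m (A *m H) = A *m H *m X.
Proof.
by move=> BA HX; rewrite -[LHS]mulmxA [B *m _]mulmxA BA mul1mx -!mulmxA HX.
Qed.

Lemma scalemx_comm (R : comPzRingType) n (a : R) (X H : 'M[R]_n) :
  H *m X = X *m H -> (a *: H) *m X = X *m (a *: H).
Proof. by move=> HX; rewrite -scalemxAl HX scalemxAr. Qed.

(** * Conjugation by constant matrices of GL2 *)

Section ConstantConjugation.
Variable K : fieldType.
Implicit Types (c : 'M[K]_2) (g : SL2 K[eps]).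

Definition const_mx_eps c : 'M[K[eps]]_2 := map_mx (qpolyC 'X^2) c.

(* Junk value: g itself if c is not invertible. *)
Definition gl_conj c g : SL2 K[eps] :=
  insubd g (const_mx_eps c *m g *m const_mx_eps (invmx c)).

Lemma const_mx_epsV c : c \in unitmx ->
  const_mx_eps c *m const_mx_eps (invmx c) = 1%:M /\
  const_mx_eps (invmx c) *m const_mx_eps c = 1%:M.
Proof. by move=> uc; rewrite -!map_mxM /= mulmxV // mulVmx // map_mx1. Qed.

Lemma gl_conjE c g : c \in unitmx ->
  gl_conj c g = const_mx_eps c *m g *m const_mx_eps (invmx c) :> 'M_2.
Proof.
move=> uc; have [cV _] := const_mx_epsV uc.
rewrite val_insubd !det_mulmx (eqP (SL2_det g)) mulr1 -det_mulmx cV det1.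
by rewrite eqxx.
Qed.

Lemma gl_conjM c : c \in unitmx -> {morph gl_conj c : x y / (x * y)%g}.
Proof.
move=> uc x y; apply: val_inj.
rewrite -[RHS]/(SL2val (gl_conj c x) *m SL2val (gl_conj c y)).
rewrite -[LHS]/(SL2val (gl_conj c (x * y)%g)).
rewrite (gl_conjE x uc) (gl_conjE y uc) (gl_conjE (x * y)%g uc).
exact: (conj_mulmx _ _ (const_mx_epsV uc).2).
Qed.

Definition diag2 (d : K) : 'M[K]_2 :=
  \matrix_(i, j) if i == j then (if i == 0 then d else 1) else 0.

Lemma det_diag2 d : \det (diag2 d) = d.
Proof. by rewrite det_mx22 !mxE /= mulr1 mulr0 subr0. Qed.

Lemma diag2_unit d : d != 0 -> diag2 d \in unitmx.
Proof. by move=> d0; rewrite unitmxE det_diag2 unitfE. Qed.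
End ConstantConjugation.

(** Applying f replaces the pair (x, y) = (a, f(a)) by (y, t y - x), which preserves the form x^2 -
    t x y + y^2. *)
Lemma lang_norm_fixed (R : comNzRingType) (f : {rmorphism R -> R}) (t a : R) :
  f t = t -> f (f a) - t * f a + a = 0 ->
  f (a ^+ 2 - t * a * f a + f a ^+ 2) = a ^+ 2 - t * a * f a + f a ^+ 2.
Proof.
move=> ft ffa; have {}ffa : f (f a) = t * f a - a.
  by apply/eqP; rewrite -subr_eq0 -ffa; apply/eqP; ring.
by rewrite rmorphD rmorphB !rmorphXn !rmorphM ft ffa; ring.
Qed.

(** For trace -2 the norm is (a + f(a))^2, and f negates a + f(a). A fixed square root of the norm
    would be a + f(a) up to sign, so a + f(a) would be both fixed and negated. *)
Lemma lang_norm_nonsquare (K : fieldType) (f : {rmorphism K -> K}) (a s : K) :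
  2%:R != 0 :> K -> f s = s -> f (f a) + 2%:R * f a + a = 0 ->
  s ^+ 2 = (a + f a) ^+ 2 -> a + f a = 0.
Proof.
move=> nz2 fs ffa /eqP s2.
have f_opp : f (a + f a) = - (a + f a).
  by apply/eqP; rewrite -subr_eq0 -ffa rmorphD; apply/eqP; ring.
have f_fix : f (a + f a) = a + f a.
  move: s2; rewrite eqf_sqr => /orP[] /eqP e; first by rewrite -e.
  by rewrite -[a + f a]opprK -e rmorphN fs.
apply/eqP; rewrite -(mulrI_eq0 _ (mulfI nz2)) mulr_natl mulr2n.
by rewrite -{1}f_fix f_opp addNr.
Qed.

(** By Cayley-Hamilton, multiplication by m acts on the coefficients of a + b m; thus F(h) = h m
    becomes F(a) = - b and F(b) = a + tr(m) b. *)
Lemma affine_mulmx22 (R : comNzRingType) (m : 'M[R]_2) (a b : R) :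
  \det m = 1 -> (a%:M + b *: m) *m m = (- b)%:M + (a + \tr m * b) *: m.
Proof.
move=> m1; rewrite mulmxDl -scalemxAl Cayley_Hamilton22 m1 mul_scalar_mx.
by apply/matrixP => i j; rewrite !mxE; case: (i == j); ring.
Qed.

(** * Solving F(h) = h g over the dual numbers *)

Section LangSteinbergSL2.
Variables (Fq : finFieldType) (k : closedFieldType) (iota : {rmorphism Fq -> k}).
Local Notation q := #|Fq|.
Local Notation Fr := (dual_map (frob iota)).
Local Notation incl := (dual_map iota).

(* For g of determinant 1 and trace t, h = a - F(a) g commutes with g, and
   F(h) = h g amounts to F(F(a)) - t F(a) + a = 0. *)
Lemma lang_commuting (t : Fq) : 2%:R != 0 :> Fq -> exists d : Fq,
  [/\ d != 0,
   (t = - 2%:R -> forall s, d != s ^+ 2) &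
   forall g : SL2 Fq[eps], \tr (red g) = t ->
     exists h : 'M[k[eps]]_2, [/\ \det h = qpolyC 'X^2 (iota d),
       h *m embed iota g = embed iota g *m h &
       map_mx Fr h = h *m embed iota g]].
Proof.
move=> nz2; have [a0 [ea0 na0]] := lang_root iota (iota t).
have [d dE] : exists d, iota d =
    a0 ^+ 2 - iota t * a0 * frob iota a0 + frob iota a0 ^+ 2.
  apply: frob_fixed.
  exact: (lang_norm_fixed (frob_iota iota t) ea0).
have d0 : d != 0 by rewrite -(fmorph_eq0 iota) dE.
exists d; split=> // [t2 s|g trg].
  (* For trace -2, [d] is the square of a0 + F(a0); were it also a square in [Fq], this sum would
     vanish, contrary to d being nonzero. *)
  apply/negP => /eqP ds.
  have nz2k : 2%:R != 0 :> k by rewrite -(rmorph_nat iota) fmorph_eq0.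
  have ab0 : a0 + frob iota a0 = 0.
    apply: (lang_norm_nonsquare nz2k (frob_iota iota s)).
      by rewrite -ea0 t2 rmorphN rmorph_nat; ring.
    by rewrite -rmorphXn -ds dE t2 rmorphN rmorph_nat; ring.
  have : iota d = (a0 + frob iota a0) ^+ 2.
    by rewrite dE t2 rmorphN rmorph_nat; ring.
  by move/eqP; rewrite ab0 expr0n fmorph_eq0 (negPf d0).
set m : 'M[k[eps]]_2 := embed iota g.
have trmE : \tr m = incl (\tr g) by rewrite trace_map_mx.
have trg0 : (\tr g)`_0 = t.
  by rewrite -trg /red /= trace_map_mx.
have detm : \det m = 1 by apply/eqP/SL2_det.
have [a1 ea1] := lang_affine_root iota (iota t) (iota (\tr g)`_1 * frob iota a0).
(* [a0] and [a1] make both coefficients of F(F(a)) - tr(m) F(a) + a vanish. *)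
pose a : k[eps] := dualn a0 a1; pose b := - Fr a.
have Frb : Fr b = a + \tr m * b.
  rewrite /b trmE; apply: dualP; rewrite !(coef_dualE, coef_dual_map) /= trg0.
    rewrite rmorphN /=; apply/eqP; rewrite -subr_eq0 -oppr_eq0 -ea0.
    by apply/eqP; ring.
  rewrite rmorphN /=; apply/eqP; rewrite -subr_eq0 -oppr_eq0.
  by rewrite -(subrr (iota (\tr g)`_1 * frob iota a0)) -{1}ea1; apply/eqP; ring.
pose h1 : 'M[k[eps]]_2 := a%:M + b *: m.
have h1m : h1 *m m = m *m h1.
  by rewrite mulmxDl mulmxDr -scalemxAl -scalemxAr scalar_mxC.
have Frm : map_mx Fr m = m := congr1 (@SL2val _) (FrobG_embed iota g).
have Frh1 : map_mx Fr h1 = h1 *m m.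
  rewrite affine_mulmx22 // map_mxD map_scalar_mx map_mxZ /= Frm -/b Frb.
  by rewrite /b opprK.
have [D DE] : exists D, incl D = \det h1.
  by apply: Frob_fixed; rewrite -det_map_mx Frh1 det_mulmx detm mulr1.
have D0 : D`_0 = d.
  apply: (fmorph_inj iota); rewrite -coef_dual_map DE det_scalar_add22 detm.
  rewrite dE -[a ^+ 2]/(a * a) -[b ^+ 2]/(b * b).
  rewrite !coef_dualE trmE coef_dual_map trg0.
  by ring.
(* The square of 1 - D_1 / (2 d) eps is 1 - D_1 / d eps, so scaling by [u] removes the
   eps-coefficient of the determinant D = d + D_1 eps. *)
pose u : Fq[eps] := dualn 1 (- D`_1 / (2%:R * d)).
have uuD : u * u * D = qpolyC 'X^2 d.
  apply: dualP; rewrite !coef_dualE D0 ?mulr1 ?mul1r //.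
  by field; rewrite d0.
exists (incl u *: h1); split.
- by rewrite -dual_map_const -uuD detZ -DE !rmorphM.
- exact: scalemx_comm.
- by rewrite map_mxZ /= Frob_incl Frh1 scalemxAl.
Qed.

(** The matrix h2 of [lang_commuting] has determinant d; multiplying it on the left by c =
    diag(d^-1, 1) brings it into SL2. As c is F-fixed and h2 commutes with g, h = c h2 satisfies
    F(h) = h g and h g h^-1 = c g c^-1. The constant provided here is therefore the inverse of the
    previous one. *)
Lemma lang_SL2 (t : Fq) : 2%:R != 0 :> Fq -> exists d : Fq,
  [/\ d != 0, t = - 2%:R -> forall s, d != s ^+ 2 &
   forall g : SL2 Fq[eps], \tr (red g) = t ->
     exists2 h : SL2 k[eps], embed iota g = (h^-1 * FrobG iota h)%g &
       embed iota (gl_conj (diag2 d) g) = (FrobG iota h * h^-1)%g].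
Proof.
move=> nz2; have [d [d0 nsq lang_d]] := lang_commuting t nz2.
have dV0 : d^-1 != 0 by rewrite invr_eq0.
exists d^-1; split=> // [t2 s|g /lang_d[h2 [deth2 h2C Frh2]]].
  by apply: contra (nsq t2 s^-1) => /eqP e; rewrite exprVn -e invrK.
pose c := const_mx_eps (diag2 d^-1).
have Frc : map_mx Fr (map_mx incl c) = map_mx incl c.
  by apply/matrixP => i j; rewrite !mxE; apply: Frob_incl.
have detH : \det (map_mx incl c *m h2) == 1.
  rewrite det_mulmx deth2 det_map_mx det_map_mx /= det_diag2 dual_map_const.
  by rewrite -rmorphM /= fmorphV mulVf ?fmorph_eq0 // rmorph1.
pose h : SL2 k[eps] := MkSL2 detH.
have Frh : FrobG iota h = (h * embed iota g)%g.
  apply: val_inj; rewrite -[LHS]/(map_mx Fr (map_mx incl c *m h2)) map_mxM Frc.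
  by rewrite Frh2 [LHS]mulmxA.
exists h; first by rewrite Frh mulKg.
rewrite Frh; apply: (canRL (mulgK _)); apply: val_inj.
rewrite -[LHS]/(map_mx incl (gl_conj (diag2 d^-1) g) *m (map_mx incl c *m h2)).
rewrite -[RHS]/(map_mx incl c *m h2 *m embed iota g).
have uc := diag2_unit dV0; rewrite (gl_conjE g uc) -/c map_mxM map_mxM.
apply: conj_mulmx_comm h2C.
by rewrite -map_mxM (const_mx_epsV uc).2 map_mx1.
Qed.
End LangSteinbergSL2.

(** * The twisting operator on class functions *)

Section ShintaniOnClassFunctions.
Variables (Fq : finFieldType) (k : closedFieldType) (iota : {rmorphism Fq -> k}).
Local Notation GF := (SL2 Fq[eps]).

(** With F(h_i) = h_i g_i, the element h1 x h2^-1 is F-fixed, and it conjugates h1 g1 h1^-1 to h2 g2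
    h2^-1. *)
Lemma n_F_class (h1 h2 : SL2 k[eps]) (g1 g2 g1' g2' x : GF) :
  embed iota g1 = (h1^-1 * FrobG iota h1)%g ->
  embed iota g1' = (FrobG iota h1 * h1^-1)%g ->
  embed iota g2 = (h2^-1 * FrobG iota h2)%g ->
  embed iota g2' = (FrobG iota h2 * h2^-1)%g ->
  g2 = (g1 ^ x)%g -> exists y, g2' = (g1' ^ y)%g.
Proof.
move=> e1 e1' e2 e2' g12.
have [y ey] : exists y, embed iota y = (h1 * embed iota x * h2^-1)%g.
  apply: FrobG_fixed; rewrite !FrobGM FrobG_embed FrobGV.
  have -> : FrobG iota h1 = (h1 * embed iota g1)%g by rewrite e1 mulKVg.
  have -> : FrobG iota h2 = (h2 * embed iota g2)%g by rewrite e2 mulKVg.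
  rewrite g12 conjgE !embedM embedV !invMg !invgK !mulgA.
  by rewrite !mulgK.
exists y; apply: (@embed_inj _ _ iota); rewrite conjgE !embedM embedV ey e1' e2'.
have F2 : FrobG iota h2 = (h2 * embed iota g2)%g by rewrite e2 mulKVg.
have F1 : FrobG iota h1 = (h1 * embed iota g1)%g by rewrite e1 mulKVg.
rewrite F1 F2 g12 conjgE !embedM embedV !invMg !invgK !mulgA.
by rewrite !mulgKV.
Qed.

(** The element g' shows that the image of the class of g is not empty, so [repr] picks a genuine
    member; by [n_F_class] that member is conjugate to g'. *)
Lemma Sh_GE (f : 'CF([set: GF])) (g g' : GF) (h : SL2 k[eps]) :
  embed iota g = (h^-1 * FrobG iota h)%g ->
  embed iota g' = (FrobG iota h * h^-1)%g -> Sh_G iota f g = f g'.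
Proof.
move=> eg eg'; rewrite cfunE.
have : g' \in n_F iota (g ^: [set: GF])%g.
  by rewrite inE; apply/asboolP; exists h => //; exists g; rewrite ?class_refl.
move/mem_repr; rewrite inE => /asboolP[h2 [g2 /imsetP[x _ g2x] eg2] er].
have [y ->] := n_F_class eg eg' eg2 er g2x.
by rewrite cfunJ ?inE.
Qed.

Lemma Sh_G_gl_conj (t : Fq) : 2%:R != 0 :> Fq -> exists d : Fq,
  [/\ d != 0, t = - 2%:R -> forall s, d != s ^+ 2 &
   forall (f : 'CF([set: GF])) (g : GF), \tr (red g) = t ->
     Sh_G iota f g = f (gl_conj (diag2 d) g)].
Proof.
move=> nz2; have [d [d0 nsq lang_d]] := lang_SL2 iota t nz2.
exists d; split=> // f g /lang_d[h eg eg']; exact: Sh_GE eg eg'.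
Qed.
End ShintaniOnClassFunctions.

(** * The kernel of reduction and the adjoint action *)

Section CongruenceKernel.
Variable K : finFieldType.
Implicit Types (X Y : sl2 K) (g h : SL2 K[eps]) (c : 'M[K]_2).

Lemma qXE : 'qX = dualn 0 1 :> K[eps].
Proof. by rewrite /dualn scale1r polyC0 add0r. Qed.

Lemma eps_scalemx n (A : 'M[K[eps]]_n) :
  'qX *: A = 'qX *: map_mx (qpolyC 'X^2) (map_mx (@eps0 K) A).
Proof.
apply/matrixP => i j; rewrite !mxE qXE.
by apply: dualP; rewrite !coef_dualE /eps0 ?mul0r.
Qed.

Lemma coef0_one_plus_eps X i j : (one_plus_eps X i j)`_0 = (i == j)%:R.
Proof.
rewrite /= !mxE qXE coef_dualD coef0_dualM coef0_dualn mul0r addr0.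
by case: (i == j); rewrite ?coef_dual1 ?coef0.
Qed.

Lemma coef1_one_plus_eps X i j : (one_plus_eps X i j)`_1 = X i j.
Proof.
rewrite /= !mxE qXE coef_dualD coef1_dualM coef0_dualn coef1_dualn coef0_const.
by rewrite mul0r mul1r add0r; case: (i == j); rewrite ?coef_dual1 ?coef0 add0r.
Qed.

Lemma red_one_plus_eps X : red (one_plus_eps X) = 1%g.
Proof.
apply: val_inj; apply/matrixP => i j.
by rewrite [LHS]mxE [RHS]mxE; apply: coef0_one_plus_eps.
Qed.

Lemma SL2_dualP g h : (forall i j, (g i j)`_0 = (h i j)`_0) ->
  (forall i j, (g i j)`_1 = (h i j)`_1) -> g = h.
Proof.
move=> e0 e1; apply: val_inj; apply/matrixP => i j.
by apply: dualP; [apply: e0 | apply: e1].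
Qed.

(** The eps-coefficient of the determinant of 1 + eps X is the trace of X. *)
Lemma red1_one_plus_eps g : red g = 1%g -> exists X, g = one_plus_eps X.
Proof.
move=> redg.
have g0 i j : (g i j)`_0 = (i == j)%:R.
  have := congr1 (fun m : SL2 K => m i j) redg.
  by rewrite /= !mxE.
pose M : 'M[K]_2 := \matrix_(i, j) (g i j)`_1.
have trM : M \in @traceless K.
  have /eqP := SL2_det g; rewrite det_mx22 => /(congr1 (fun a : K[eps] => a`_1)).
  rewrite !coef_dualE !g0 /= !mul0r !mulr0 mul1r mulr1 !addr0 subr0 => e.
  by rewrite /in_mem /= /traceless mxtrace22 !mxE addrC e.
exists (MkSl2 trM); apply: SL2_dualP => i j.
  by rewrite coef0_one_plus_eps g0.
by rewrite coef1_one_plus_eps /= mxE.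
Qed.

Lemma one_plus_epsD X Y :
  one_plus_eps (X + Y) = (one_plus_eps X * one_plus_eps Y)%g.
Proof.
have qX2 : 'qX * 'qX = 0 :> K[eps].
  by rewrite qXE; apply: dualP; rewrite !coef_dualE !(mul0r, mulr0) ?addr0.
apply: val_inj; rewrite -[RHS]/(one_plus_eps_mx X *m one_plus_eps_mx Y).
rewrite -[LHS]/(one_plus_eps_mx (sl2val X + sl2val Y)) /one_plus_eps_mx.
rewrite map_mxD scalerDr mulmxDl mul1mx mulmxDr mulmx1 -scalemxAl -scalemxAr scalerA.
rewrite qX2 scale0r addr0 -[RHS]addrA; congr (_ + _); exact: addrC.
Qed.

Definition SL2_lift (s : SL2 K) : SL2 K[eps] := SL2map (qpolyC 'X^2) s.

Lemma red_lift s : red (SL2_lift s) = s.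
Proof.
by apply: val_inj; apply/matrixP => i j; rewrite !mxE; apply: coef0_const.
Qed.

Lemma redM : {morph @red K : x y / (x * y)%g}. Proof. exact: SL2mapM. Qed.

Lemma redV g : red g^-1%g = ((red g)^-1)%g.
Proof. by apply: (mulgI (red g)); rewrite -redM !mulgV /red SL2map1. Qed.

Lemma lift_one_plus_eps g : exists X, g = (SL2_lift (red g) * one_plus_eps X)%g.
Proof.
have [|X gX] := @red1_one_plus_eps ((SL2_lift (red g))^-1 * g)%g.
  by rewrite redM redV red_lift mulVg.
by exists X; rewrite -gX mulKVg.
Qed.

(* Meaningful only for c invertible. *)
Definition GLAd c X : sl2 K := insubd X (c *m X *m invmx c).

Lemma GLAdE c X : c \in unitmx -> GLAd c X = c *m X *m invmx c :> 'M_2.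
Proof.
move=> uc; rewrite val_insubd ifT //.
by rewrite /in_mem /= /traceless mxtrace_mulC mulmxA mulVmx // mul1mx; apply: sl2_tr.
Qed.

Lemma gl_conj_one_plus_eps c X : c \in unitmx ->
  gl_conj c (one_plus_eps X) = one_plus_eps (GLAd c X).
Proof.
move=> uc; apply: val_inj; rewrite /= gl_conjE //= /one_plus_eps_mx GLAdE //.
rewrite mulmxDr mulmxDl mulmx1 (const_mx_epsV uc).1 !map_mxM.
by rewrite -scalemxAr -scalemxAl.
Qed.

Lemma one_plus_eps_conj g X :
  (one_plus_eps X ^ g^-1)%g = one_plus_eps (Ad (red g) X).
Proof.
rewrite conjgE invgK mulgA; apply: val_inj.
rewrite -[LHS]/(SL2val g *m (1%:M + 'qX *: map_mx (qpolyC 'X^2) X) *m SL2val g^-1%g).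
rewrite mulmxDr mulmxDl mulmx1 -[_ *m SL2val _]/(SL2val (g * g^-1)%g) mulgV.
rewrite -scalemxAr -scalemxAl eps_scalemx -[RHS]/(one_plus_eps_mx _).
rewrite /one_plus_eps_mx; congr (_ + 'qX *: map_mx _ _).
rewrite -[RHS]/(red g *m X *m (red g)^-1%g) map_mxM map_mxM -redV.
congr (_ *m _ *m _); apply/matrixP => i j; rewrite !mxE; exact: coef0_const.
Qed.
End CongruenceKernel.

(** * Traceless matrices over a field of characteristic other than 2 *)

Section TracelessMatrices.
Variable K : fieldType.
Hypothesis nz2 : 2%:R != 0 :> K.
Implicit Types X M : 'M[K]_2.

Lemma traceless_sqr X : \tr X = 0 -> X *m X = (- \det X)%:M.
Proof. by move=> tr0; rewrite Cayley_Hamilton22 tr0 scale0r sub0r raddfN. Qed.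

(** A nonzero traceless matrix is not scalar because 2 is nonzero, so its commutant consists of the
    polynomials in it. The coefficients are read off at a nonzero off-diagonal entry, or from the
    diagonal if there is none. *)
Lemma commutant_traceless X M : \tr X = 0 -> X != 0 -> M *m X = X *m M ->
  exists ab : K * K, M = ab.1%:M + ab.2 *: X.
Proof.
rewrite mxtrace22 => /eqP; rewrite addrC addr_eq0 => /eqP X11 X0 MX.
have e i j : M i 0 * X 0 j + M i 1 * X 1 j = X i 0 * M 0 j + X i 1 * M 1 j.
  by rewrite -!mulmx22E MX.
have [[e00 e01] e10] := (e 0 0, e 0 1, e 1 0).
clear e; rewrite X11 in e01 e10.
suff ex : exists ab : K * K,
    [/\ M 0 0 = ab.1 + ab.2 * X 0 0, M 0 1 = ab.2 * X 0 1,
        M 1 0 = ab.2 * X 1 0 & M 1 1 = ab.1 - ab.2 * X 0 0].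
  have [[al be] [h00 h01 h10 h11]] := ex; exists (al, be).
  apply: matrix2P; rewrite !mxE /= ?mulr1n ?mulr0n ?add0r //.
  by rewrite X11 mulrN.
(* Each identity below is a commutation relation up to a nonzero factor; [lin] leaves this to [ring]
   or [field]. *)
have lin (u v w : K) : v = w -> u = v - w -> u = 0 by move=> vw ->; rewrite vw subrr.
have [b0|b0] := eqVneq (X 0 1) 0; last first.
  exists (M 0 0 - M 0 1 / X 0 1 * X 0 0, M 0 1 / X 0 1); split=> /=.
  - by rewrite subrK.
  - by rewrite divfK.
  - apply: (mulIf b0); rewrite mulrAC divfK //; apply/eqP; rewrite -subr_eq0.
    by apply/eqP/(lin _ _ _ (esym e00)); ring.
  - apply: (mulIf b0); apply/eqP; rewrite -subr_eq0; apply/eqP.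
    by apply: (lin _ _ _ (esym e01)); field.
have [c0|c0] := eqVneq (X 1 0) 0; last first.
  exists (M 0 0 - M 1 0 / X 1 0 * X 0 0, M 1 0 / X 1 0); split=> /=.
  - by rewrite subrK.
  - apply: (mulIf c0); rewrite b0 mulr0 mul0r; apply/eqP; rewrite -subr_eq0.
    apply/eqP/(lin _ _ _ e00); rewrite b0; ring.
  - by rewrite divfK.
  - apply: (mulIf c0); apply/eqP; rewrite -subr_eq0; apply/eqP.
    by apply: (lin _ _ _ e10); field.
have a0 : X 0 0 != 0.
  apply: contra X0 => /eqP a0; apply/eqP/matrix2P; rewrite ?mxE //.
  by rewrite X11 a0 oppr0.
have m01 : M 0 1 = 0.
  have : 2%:R * X 0 0 * M 0 1 = 0.
    by apply: (lin _ _ _ (esym e01)); rewrite b0; ring.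
  by move/eqP; rewrite !mulf_eq0 (negPf nz2) (negPf a0) => /eqP.
have m10 : M 1 0 = 0.
  have : 2%:R * X 0 0 * M 1 0 = 0.
    by apply: (lin _ _ _ e10); rewrite c0; ring.
  by move/eqP; rewrite !mulf_eq0 (negPf nz2) (negPf a0) => /eqP.
exists ((M 0 0 + M 1 1) / 2%:R, (M 0 0 - M 1 1) / (2%:R * X 0 0)).
rewrite m01 m10 b0 c0 !mulr0 /=; split=> //.
  by field; rewrite a0 nz2.
by field; rewrite a0 nz2.
Qed.

(** Here X^2 = - det X. If det X = 0, a diagonal form of X squares to zero and hence is zero.
    Otherwise X is killed by (T - r) (T + r) with r^2 = - det X, and r differs from - r. *)
Lemma diagonalizable_traceless (L : closedFieldType) (iota : {rmorphism K -> L}) X :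
  \tr X = 0 -> X != 0 -> diagonalizable (map_mx iota X) <-> \det X != 0.
Proof.
move=> trX X0; split=> [[P uP /similar_diagPex[D /(similarP uP) PX]]|dX].
  apply: contra X0 => /eqP dX.
  have X2 : map_mx iota X *m map_mx iota X = 0.
    by rewrite -map_mxM traceless_sqr // dX oppr0 raddf0 map_mx0.
  have D2 : diag_mx D *m diag_mx D = 0.
    have -> : diag_mx D = P *m map_mx iota X *m invmx P by rewrite PX mulmxK.
    by rewrite -(conj_mulmx _ _ (mulVmx uP)) X2 mulmx0 mul0mx.
  have D0 : D = 0.
    apply/rowP => j; have := congr1 (fun M : 'M_2 => M j j) D2.
    rewrite mulmx_diag !mxE eqxx mulr1n => /eqP.
    by rewrite mulf_eq0 orbb => /eqP.
  rewrite -(map_mx_eq0 iota); apply/eqP.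
  by rewrite -(mulKmx uP (map_mx iota X)) PX D0 raddf0 mul0mx mulmx0.
apply/diagonalizableP.
have [r rE] : exists r, r ^+ 2 = - iota (\det X).
  have /closed_rootP[r] : size ('X^2 - (- iota (\det X))%:P : {poly L}) != 1%N.
    by rewrite size_XnsubC.
  rewrite rootE hornerD hornerN hornerXn hornerC subr_eq0 => /eqP rE.
  by exists r.
exists [:: r; - r].
  rewrite /= inE andbT -subr_eq0 opprK -mulr2n -mulr_natl mulf_neq0 //.
    by rewrite -(rmorph_nat iota) fmorph_eq0.
  by rewrite -sqrf_eq0 rE oppr_eq0 fmorph_eq0.
rewrite !big_cons big_nil mulr1 dvd_mxminpoly polyCN opprK.
have -> : ('X - r%:P) * ('X + r%:P) = 'X * 'X - (r ^+ 2)%:P.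
  by rewrite polyC_exp; ring.
rewrite rmorphB rmorphM /= horner_mx_X horner_mx_C rE.
rewrite -[_ * _]/(map_mx iota X *m map_mx iota X) -map_mxM traceless_sqr //.
by rewrite map_scalar_mx /= rmorphN subrr.
Qed.
End TracelessMatrices.

(** * Squares in a finite field *)

Section FiniteFieldSquares.
Variable F : finFieldType.

Let sq := [set x ^+ 2 | x : F].

(** A nonzero square has at most two square roots and 0 has one, so q is at most 2 s - 1 if there
    are s squares. *)
Lemma card_squares : (#|F| < 2 * #|sq|)%N.
Proof.
have sq0 : 0 \in sq by apply/imsetP; exists 0; rewrite ?inE // expr0n.
rewrite -[#|F|]sum1_card.
rewrite (partition_big (fun x => x ^+ 2) (mem sq)) => /=; last first.
  by move=> x _; apply: imset_f.
rewrite (bigD1 0) //= (big_pred1 0) => [|x]; last by rewrite /= sqrf_eq0.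
rewrite (cardD1 0) sq0 mulnDr muln1 ltnS add1n ltnS mulnC -sum_nat_const.
rewrite [leqRHS](eq_bigl (fun y => (y \in sq) && (y != 0))) => [|y]; last first.
  by rewrite !inE andbC.
apply: leq_sum => y /andP[/imsetP[x _ ->] _]; rewrite sum1_card.
apply: (@leq_trans #|[set x; - x]|); last by rewrite cards2; case: eqP.
apply/subset_leq_card/subsetP => z.
by rewrite -[X in X -> _]/(is_true (z ^+ 2 == x ^+ 2)) eqf_sqr !inE.
Qed.

(** The squares and the values nu - D y^2 each fill more than half of the field, so they meet. Since
    det (x + y X) = x^2 + y^2 det X for traceless X, this makes the determinant surjective on the
    centralizer of X. *)
Lemma norm_form_surj (D nu : F) : D != 0 -> exists x y, x ^+ 2 + D * y ^+ 2 = nu.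
Proof.
move=> D0; pose B := [set nu - D * y | y in sq].
have cardB : #|B| = #|sq| by apply: card_imset => y z /addrI/oppr_inj/(mulfI D0).
have : ~~ [disjoint sq & B].
  apply/negP => dis.
  have /eqP e : #|sq :|: B| == (#|sq| + #|B|)%N by rewrite (leq_card_setU sq B).2.
  have := max_card (mem (sq :|: B)).
  by rewrite e cardB addnn -mul2n leqNgt card_squares.
case/pred0Pn => z /andP[/imsetP[x _ ->] /imsetP[_ /imsetP[y _ ->] e]].
by exists x, y; rewrite e subrK.
Qed.
End FiniteFieldSquares.

(** * The invariant form over the finite field *)

Section InvariantForm.
Variables (Fq : finFieldType) (k : closedFieldType) (iota : {rmorphism Fq -> k}).
Variables (mu : {biscalar sl2 k}) (muq : sl2 Fq -> sl2 Fq -> Fq).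
Hypotheses (mu_nondeg : nondegenerate_form mu) (mu_inv : SL2_invariant mu).
Hypothesis mu_Fq : defined_over iota mu muq.
Implicit Types (X Y Z : sl2 Fq) (c : 'M[Fq]_2).

Lemma sl2mapD X Y : sl2map iota (X + Y) = sl2map iota X + sl2map iota Y.
Proof. by apply: val_inj; rewrite /= map_mxD. Qed.

Lemma sl2mapZ a X : sl2map iota (a *: X) = iota a *: sl2map iota X.
Proof. by apply: val_inj; rewrite /= map_mxZ. Qed.

Lemma form_DrE X Y Z : muq X (Y + Z) = muq X Y + muq X Z.
Proof. by apply: (fmorph_inj iota); rewrite rmorphD -!mu_Fq sl2mapD linearDr. Qed.

Lemma form_ZrE X a Y : muq X (a *: Y) = a * muq X Y.
Proof. by apply: (fmorph_inj iota); rewrite rmorphM -!mu_Fq sl2mapZ linearZr_LR. Qed.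

Lemma form_DlE X Y Z : muq (X + Y) Z = muq X Z + muq Y Z.
Proof. by apply: (fmorph_inj iota); rewrite rmorphD -!mu_Fq sl2mapD linearDl. Qed.

Lemma form_BlE X Y Z : muq (X - Y) Z = muq X Z - muq Y Z.
Proof. by apply/eqP; rewrite -subr_eq opprK -form_DlE subrK. Qed.

Definition sl2_mk (K : comNzRingType) (a b c : K) : sl2 K :=
  insubd 0 (\matrix_(i, j) if i == 0 then (if j == 0 then a else b)
                           else (if j == 0 then c else - a)).

Lemma sl2_mkE (K : comNzRingType) (X : sl2 K) : X = sl2_mk (X 0 0) (X 0 1) (X 1 0).
Proof.
have X11 : X 1 1 = - X 0 0.
  by apply/eqP; rewrite -addr_eq0 addrC -mxtrace22; exact: sl2_tr.
apply: val_inj; rewrite val_insubd ifT; last first.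
  by rewrite /in_mem /= /traceless mxtrace22 !mxE subrr.
by apply: matrix2P; rewrite !mxE.
Qed.

Lemma val_sl2_mk (K : comNzRingType) (a b c : K) i j : sl2_mk a b c i j =
  if i == 0 then (if j == 0 then a else b) else (if j == 0 then c else - a).
Proof.
rewrite val_insubd ifT ?mxE //.
by rewrite /in_mem /= /traceless mxtrace22 !mxE subrr.
Qed.

(** Non-degeneracy descends from [k], because the standard basis of sl2 over [k] comes from [Fq]. *)
Lemma form_nondeg X : (forall Y, muq X Y = 0) -> X = 0.
Proof.
move=> X0; have kX0 : sl2map iota X = 0.
  apply: (proj1 mu_nondeg) => Z.
  have -> : Z = Z 0 0 *: sl2map iota (sl2_mk 1 0 0)
      + Z 0 1 *: sl2map iota (sl2_mk 0 1 0) + Z 1 0 *: sl2map iota (sl2_mk 0 0 1).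
    rewrite {1}[Z]sl2_mkE; apply: val_inj; apply: matrix2P;
      rewrite val_sl2_mk !mxE !val_sl2_mk /=;
      rewrite ?(rmorph0, rmorph1, rmorphN, oppr0) /=; ring.
  rewrite !linearDr !linearZr_LR /= !mu_Fq !X0 rmorph0 !mulr0 !addr0 //.
apply: val_inj; apply: (map_mx_inj (f := iota)).
by rewrite /= map_mx0; have := congr1 (@sl2val _) kX0.
Qed.

(* Over the algebraically closed field k, c is a scalar times an element of SL2. *)
Lemma form_GLAd c X Y : c \in unitmx -> muq (GLAd c X) (GLAd c Y) = muq X Y.
Proof.
move=> uc; have dc : \det c != 0 by rewrite -unitfE -unitmxE.
have [s s2] : exists s, s ^+ 2 = iota (\det c).
  have /closed_rootP[s] : size ('X^2 - (iota (\det c))%:P : {poly k}) != 1%N.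
    by rewrite size_XnsubC.
  by rewrite rootE hornerD hornerN hornerXn hornerC subr_eq0 => /eqP s2; exists s.
have s0 : s != 0 by rewrite -sqrf_eq0 s2 fmorph_eq0.
have det_h : \det (s^-1 *: map_mx iota c) == 1.
  by rewrite detZ det_map_mx exprVn s2 mulVf // fmorph_eq0.
pose h : SL2 k := MkSL2 det_h.
have hV : SL2val h^-1%g = s *: map_mx iota (invmx c).
  have hA : SL2val h *m (s *: map_mx iota (invmx c)) = 1%:M.
    rewrite -scalemxAl -scalemxAr scalerA mulVf // scale1r.
    by rewrite -map_mxM mulmxV ?map_mx1.
  rewrite -[LHS]mulmx1 -hA mulmxA.
  by rewrite -[SL2val h^-1%g *m h]/(SL2val (h^-1 * h)%g) mulVg mul1mx.
have AdE Z : sl2map iota (GLAd c Z) = Ad h (sl2map iota Z).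
  apply: val_inj; rewrite /= GLAdE // !map_mxM -[\adj _]/(SL2val h^-1%g) hV.
  by rewrite -!scalemxAl -scalemxAr scalerA mulVf // scale1r.
by apply: (fmorph_inj iota); rewrite -!mu_Fq !AdE mu_inv.
Qed.
End InvariantForm.

(** An element whose character value has absolute value chi(1) acts by a scalar. *)
Lemma char_mul_norm1 (gT : finGroupType) (G : {group gT}) (chi : 'CF(G)) x z :
  chi \is a character -> x \in G -> z \in G -> `|chi z| = chi 1%g ->
  chi (x * z)%g * chi 1%g = chi x * chi z.
Proof.
move=> /char_reprP[rG ->] Gx Gz /(max_cfRepr_norm_scalar Gz)[a _ rz].
rewrite !cfunE groupM // Gx Gz group1 !mulr1n repr_mxM // rz repr_mx1.
by rewrite mul_mx_scalar mxtraceZ !mxtrace_scalar -(mulr_natr a) mulrA (mulrC a).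
Qed.

Lemma gl_conj_mul (K : fieldType) (a b : 'M[K]_2) (g : SL2 K[eps]) :
  a \in unitmx -> b \in unitmx -> gl_conj (a *m b) g = gl_conj a (gl_conj b g).
Proof.
move=> ua ub; have uab : a *m b \in unitmx by rewrite unitmx_mul ua.
apply: val_inj; rewrite /=.
rewrite (gl_conjE _ uab) (gl_conjE _ ua) (gl_conjE _ ub).
have -> : invmx (a *m b) = invmx b *m invmx a := invrM ua ub.
rewrite /const_mx_eps.
by rewrite !map_mxM !mulmxA.
Qed.

Lemma gl_conj1 (K : fieldType) (g : SL2 K[eps]) : gl_conj 1%:M g = g.
Proof.
apply: val_inj; rewrite /= gl_conjE ?unitmx1 // invmx1 /const_mx_eps map_mx1.
by rewrite mulmx1 mul1mx.
Qed.

Lemma gl_conjK (K : fieldType) (c : 'M[K]_2) : c \in unitmx ->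
  cancel (gl_conj c) (gl_conj (invmx c)).
Proof. by move=> uc g; rewrite -gl_conj_mul ?unitmx_inv // mulVmx // gl_conj1. Qed.

Lemma GLAdK (K : finFieldType) (c : 'M[K]_2) : c \in unitmx ->
  cancel (GLAd c) (GLAd (invmx c)).
Proof.
move=> uc X; apply: val_inj; rewrite /= !GLAdE ?unitmx_inv // invmxK.
by rewrite !mulmxA mulVmx // mul1mx mulmxKV.
Qed.

(** * Coordinates on the congruence kernel *)

Section CongruenceKernelCharacters.
Variables (Fq : finFieldType).
Local Notation GF := (SL2 Fq[eps]).
Local Notation G := [set: GF]%G.
Local Notation K := (cong_ker_group Fq).
Implicit Types (X Y Z : sl2 Fq) (c : 'M[Fq]_2) (g : GF).

Lemma SL2_unitmx (R : comUnitRingType) (s : SL2 R) : SL2val s \in unitmx.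
Proof. by rewrite unitmxE (eqP (SL2_det s)) unitr1. Qed.

Lemma SL2_invmx (R : comUnitRingType) (s : SL2 R) : invmx s = SL2val s^-1%g.
Proof.
rewrite -[RHS]mulmx1 -(mulmxV (SL2_unitmx s)) mulmxA.
by rewrite -[SL2val s^-1%g *m s]/(SL2val (s^-1 * s)%g) mulVg mul1mx.
Qed.

Lemma Ad_GLAd (s : SL2 Fq) X : Ad s X = GLAd s X.
Proof.
by apply: val_inj; rewrite /= GLAdE ?SL2_unitmx // SL2_invmx.
Qed.

Lemma gl_conj_SL2 (s : SL2 Fq) g :
  gl_conj s g = (g ^ (SL2_lift s)^-1)%g.
Proof.
rewrite conjgE invgK mulgA; apply: val_inj.
rewrite -[LHS]/(SL2val (gl_conj s g)) (gl_conjE g (SL2_unitmx s)) SL2_invmx.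
rewrite -[RHS]/(SL2val (SL2_lift s) *m g *m SL2val (SL2_lift s)^-1%g).
have liftV : SL2_lift s^-1%g = ((SL2_lift s)^-1)%g.
  by apply: (mulgI (SL2_lift s)); rewrite -SL2mapM !mulgV /SL2_lift SL2map1.
by rewrite -liftV.
Qed.

Lemma cong_ker_normal : (K <| G)%g.
Proof.
rewrite /normal subsetT; apply/subsetP => x _; rewrite inE.
apply/subsetP => _ /imsetP[y + ->]; rewrite !inE conjgE !redM redV => /eqP->.
by rewrite mul1g mulVg.
Qed.

Lemma one_plus_eps_in X : one_plus_eps X \in K.
Proof. by rewrite inE red_one_plus_eps. Qed.

Lemma cong_kerP g : g \in K -> exists X, g = one_plus_eps X.
Proof. by rewrite inE => /eqP; apply: red1_one_plus_eps. Qed.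

(** The logarithm on the kernel of reduction; the default [0] is taken when the matrix of
    eps-coefficients is not traceless. *)
Definition eps_part g : sl2 Fq := insubd 0 (\matrix_(i, j) (g i j)`_1).

Lemma one_plus_epsK : cancel (@one_plus_eps Fq) eps_part.
Proof.
move=> X; apply: val_inj; rewrite val_insubd.
have -> : (\matrix_(i, j) (one_plus_eps X i j)`_1) = X.
  by apply/matrixP => i j; rewrite mxE coef1_one_plus_eps.
by rewrite (sl2_tr X).
Qed.

Lemma big_cong_ker (V : nmodType) (F : GF -> V) :
  \sum_(u in K) F u = \sum_X F (one_plus_eps X).
Proof.
rewrite (reindex (@one_plus_eps Fq)) /=.
  by apply: eq_bigl => X; rewrite one_plus_eps_in.
by exists eps_part => [X _|_ /cong_kerP[X ->]]; rewrite one_plus_epsK.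
Qed.

Lemma cong_ker_cfunP (f g : 'CF(K)) :
  (forall Y, f (one_plus_eps Y) = g (one_plus_eps Y)) -> f = g.
Proof. by move=> fg; apply/cfun_inP => _ /cong_kerP[Y ->]. Qed.

Lemma red_gl_conj c g : c \in unitmx ->
  red (gl_conj c g) = c *m red g *m invmx c :> 'M_2.
Proof.
move=> uc; rewrite /= gl_conjE // !map_mxM.
by congr (_ *m _ *m _); apply/matrixP => i j; rewrite !mxE; apply: coef0_const.
Qed.
End CongruenceKernelCharacters.

(** * Orbits of irreducible characters *)

Section OrbitCharacters.
Variables (Fq : finFieldType) (k : closedFieldType) (iota : {rmorphism Fq -> k}).
Variables (mu : {biscalar sl2 k}) (muq : sl2 Fq -> sl2 Fq -> Fq).
Hypotheses (mu_nondeg : nondegenerate_form mu) (mu_inv : SL2_invariant mu).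
Hypothesis mu_Fq : defined_over iota mu muq.
Variable phi : 'CF([set: Fq]).
Hypotheses (phi_lin : phi \is a linear_char) (phi_nt : phi != 1).
Local Notation GF := (SL2 Fq[eps]).
Local Notation G := [set: GF]%G.
Local Notation K := (cong_ker_group Fq).
Implicit Types (X Y Z : sl2 Fq) (c : 'M[Fq]_2) (g : GF).

Lemma form_eps_part_morph X :
  {in K &, {morph (fun g => muq X (eps_part g)) : x y / (x * y)%g}}.
Proof.
move=> _ _ /cong_kerP[Y ->] /cong_kerP[Z ->].
by rewrite -one_plus_epsD !one_plus_epsK (form_DrE mu_Fq).
Qed.
Definition form_morphism X := Morphism (form_eps_part_morph X).

(** The pull-back of [phi] along 1 + eps Y |-> [muq X Y]; [phi] is first restricted to the image, as
    [cfMorph] requires. *)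
Definition orbit_char X : 'CF(K) :=
  cfMorph ('Res[form_morphism X @* K] phi).

Lemma orbit_charE X Y : orbit_char X (one_plus_eps Y) = phi (muq X Y).
Proof.
rewrite cfMorphE ?one_plus_eps_in // cfResE ?subsetT //=.
  by rewrite one_plus_epsK.
by apply: mem_morphim; apply: one_plus_eps_in.
Qed.

Lemma orbit_char_lin X : orbit_char X \is a linear_char.
Proof. by apply/cfMorph_lin_char/cfRes_lin_char. Qed.

(** If X and X' differ, the form [muq (X - X')] is onto [Fq], and [phi] is trivial on its values,
    hence everywhere. *)
Lemma orbit_char_inj X X' :
  (forall Y, phi (muq X Y) = phi (muq X' Y)) -> X = X'.
Proof.
move=> e; apply/eqP; rewrite -subr_eq0; apply/eqP.
apply: (form_nondeg mu_nondeg mu_Fq) => Y; apply/eqP; apply: contraNT phi_nt => nz.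
apply/eqP/cfun_inP => a _; rewrite cfun1E inE.
have -> : a = muq (X - X') ((a / muq (X - X') Y) *: Y).
  by rewrite (form_ZrE mu_Fq) divfK.
have phi0 : phi 0%R = 1 := lin_char1 phi_lin.
have phiD x y : phi (x + y) = phi x * phi y.
  exact: (lin_charM phi_lin (in_setT x) (in_setT y)).
rewrite (form_BlE mu_Fq) phiD e -phiD subrr; exact: phi0.
Qed.

(** By counting: the kernel is abelian with at most as many elements as sl2 over [Fq], and the
    characters [orbit_char X] are pairwise distinct. *)
Lemma orbit_charP (j : Iirr K) : exists X, 'chi_j = orbit_char X.
Proof.
have chiE X : 'chi_(cfIirr (orbit_char X)) = orbit_char X.
  exact/cfIirrE/lin_char_irr/orbit_char_lin.
have idx_inj : injective (fun X => cfIirr (orbit_char X)).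
  move=> X X' /(congr1 (fun j => 'chi_j)); rewrite !chiE => e.
  by apply: orbit_char_inj => Y; rewrite -!orbit_charE e.
have Kab : abelian K.
  apply/centsP => _ /cong_kerP[Y ->] _ /cong_kerP[Z ->].
  by rewrite /commute -!one_plus_epsD addrC.
have card_le : (#|Iirr K| <= #|{: sl2 Fq}|)%N.
  rewrite (card_Iirr_abelian Kab).
  have -> : K = [set one_plus_eps Y | Y : sl2 Fq] :> {set _}.
    apply/setP => g; apply/idP/imsetP => [/cong_kerP[Y ->]|[Y _ ->]].
      by exists Y.
    exact: one_plus_eps_in.
  exact: leq_imset_card.
have [f _ fK] := inj_card_bij idx_inj card_le.
by exists (f j); rewrite -[in LHS](fK j) chiE.
Qed.

Lemma orbit_char_conj X g Y : (orbit_char X ^ g)%CF (one_plus_eps Y) =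
  phi (muq (Ad (red g)^-1%g X) Y).
Proof.
have Ng : g \in 'N(K)%g by rewrite (subsetP (normal_norm (cong_ker_normal Fq))) ?inE.
rewrite cfConjgE // one_plus_eps_conj orbit_charE.
congr (phi _); rewrite !Ad_GLAd -SL2_invmx.
rewrite -[LHS](form_GLAd mu_inv mu_Fq _ _ (_ : invmx (red g) \in unitmx)); last first.
  by rewrite unitmx_inv SL2_unitmx.
by rewrite GLAdK ?SL2_unitmx.
Qed.

Lemma mem_orbit_of (R : 'CF(G)) X : X \in orbit_of muq phi R ->
  exists2 j, j \in irr_constt ('Res[K] R) & 'chi_j = orbit_char X.
Proof.
rewrite inE => /existsP[j /andP[Rj /forallP e]]; exists j => //.
by apply: cong_ker_cfunP => Y; rewrite orbit_charE; apply/eqP.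
Qed.

Lemma orbit_of_nonempty (i : Iirr G) : exists X, X \in orbit_of muq phi 'chi_i.
Proof.
have [j Rj] := neq0_has_constt (Res_irr_neq0 K i).
have [X jX] := orbit_charP j.
exists X; rewrite inE; apply/existsP; exists j; rewrite Rj.
by apply/forallP => Y; rewrite jX orbit_charE.
Qed.

(** If X = 0, the restriction to the kernel of reduction contains the trivial character, so that
    kernel acts trivially by Clifford and the character factors through [red], by evaluation at
    constant lifts. *)
Lemma primitive_orbit_neq0 (i : Iirr G) X : primitive_char 'chi_i ->
  X \in orbit_of muq phi 'chi_i -> X != 0.
Proof.
move=> prim /mem_orbit_of[j Rj jX]; apply/eqP => X0; apply: prim.
have j0 : j = 0.
  apply/irr_inj; rewrite irr0 jX; apply: cong_ker_cfunP => Y.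
  rewrite orbit_charE cfun1E one_plus_eps_in X0.
  have -> : muq 0 Y = 0 by rewrite -(subrr X) (form_BlE mu_Fq) subrr.
  exact: lin_char1 phi_lin.
have Kker : K \subset cfker 'chi_i.
  by apply: (constt0_Res_cfker (cong_ker_normal Fq)); rewrite -j0.
have fP : is_class_fun <<[set: SL2 Fq]>>%g [ffun s => 'chi_i (SL2_lift s)].
  rewrite genGid; apply: intro_class_fun => [x y _ _ | x]; last by rewrite inE.
  have -> : SL2_lift (x ^ y)%g = (SL2_lift x ^ SL2_lift y)%g.
    by apply: (mulgI (SL2_lift y)); rewrite -conjgC -!SL2mapM -conjgC.
  by rewrite cfunJ ?inE.
exists (Cfun 0 fP) => g; rewrite cfunE.
have [Y {1}->] := lift_one_plus_eps g.
by rewrite cfkerMr // (subsetP Kker) // one_plus_eps_in.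
Qed.

Lemma orbit_char_inertia (j : Iirr K) X g : 'chi_j = orbit_char X ->
  (g \in 'I_G['chi_j]%g) = (red g *m X == X *m red g).
Proof.
move=> jX; have Ng : g \in 'N(K)%g.
  by rewrite (subsetP (normal_norm (cong_ker_normal Fq))) ?inE.
rewrite in_setI in_setT jX /= /inertia in_set Ng /=; apply/eqP/eqP => [e|gX].
  have AdX : Ad (red g)^-1%g X = X.
    by apply: orbit_char_inj => Y; rewrite -orbit_char_conj e orbit_charE.
  have := congr1 (fun Z : sl2 Fq => red g *m Z) AdX; rewrite Ad_GLAd.
  rewrite GLAdE ?SL2_unitmx // -SL2_invmx invmxK !mulmxA mulmxV ?SL2_unitmx //.
  by rewrite mul1mx.
apply: cong_ker_cfunP => Y; rewrite orbit_char_conj orbit_charE.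
congr (phi (muq _ _)); rewrite Ad_GLAd; apply: val_inj.
rewrite -[LHS]/(sl2val (GLAd _ X)) GLAdE ?SL2_unitmx // -SL2_invmx invmxK.
rewrite -mulmxA -gX mulmxA.
by rewrite mulVmx ?SL2_unitmx // mul1mx.
Qed.

(** The matrix c = a + b X fixes X, so conjugation by it preserves the inertia group T of the
    character of X. It also fixes the character of T from which ['chi_i] is induced. *)
Lemma orbit_irr_gl_invariant_comm (i : Iirr G) X (a b : Fq) g :
  X \in orbit_of muq phi 'chi_i ->
  a%:M + b *: sl2val X \in unitmx ->
  'chi_i (gl_conj (a%:M + b *: sl2val X) g) = 'chi_i g.
Proof.
move=> /mem_orbit_of[j ij jX]; set c := a%:M + _ => uc.
have trX : \tr X = 0 := eqP (sl2_tr X).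
have cX : c *m X = X *m c.
  by rewrite mulmxDl mulmxDr -scalemxAl -scalemxAr scalar_mxC.
have GLAdX : GLAd c X = X.
  by apply: val_inj; rewrite /= GLAdE // cX mulmxK.
have c_comm M : (M *m X == X *m M) -> c *m M = M *m c.
  move=> /eqP MX; rewrite mulmxDl mulmxDr -scalemxAl -scalemxAr -MX.
  by rewrite scalar_mxC.
pose T := 'I_G['chi_j]%G.
have nsKG := cong_ker_normal Fq.
have sKG := normal_sub nsKG.
have nsKT : (K <| T)%g := normal_Inertia _ sKG.
(* Clifford correspondence: ['chi_i] is induced from some ['chi_s] of [T], whose restriction to [K]
   is a multiple of the [T]-invariant ['chi_j]. *)
have [irrT _ imT _ _] := constt_Inertia_bijection j nsKG.
have : i \in irr_constt ('Ind[G] 'chi_j) by rewrite constt_Ind_Res.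
rewrite -imT => /imsetP[s Ts iE].
have {iE} chi_i : 'chi_i = 'Ind[G] 'chi_s by rewrite iE cfIirrE ?irrT.
have resT : 'Res[K] 'chi_s = '['Res[K] 'chi_s, 'chi_j] *: 'chi_j.
  rewrite {1}(Clifford_Res_sum_cfclass nsKT (_ : j \in _)) -?constt_Ind_Res //.
  by rewrite cfclass_invariant ?subsetIr // big_seq1.
set e := '[_, _] in resT.
have sK Y : 'chi_s (one_plus_eps Y) = e * phi (muq X Y).
  rewrite -(cfResE _ (normal_sub nsKT)) ?one_plus_eps_in // resT cfunE jX.
  by rewrite orbit_charE.
have TE x : (x \in T) = (red x *m X == X *m red x) := orbit_char_inertia x jX.
have TJ x : (gl_conj c x \in T) = (x \in T).
  rewrite !TE -(inj_eq (can_inj (mulmxK uc))).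
  rewrite -[in RHS](inj_eq (can_inj (mulKmx uc))).
  rewrite red_gl_conj //; congr (_ == _).
    by rewrite -!mulmxA -cX (mulKmx uc) !mulmxA.
  by rewrite -!mulmxA (mulVmx uc) mulmx1 !mulmxA cX.
have s1 : 'chi_s 1%g = e.
  have ope0 : one_plus_eps (0 : sl2 Fq) = 1%g.
    by apply: (mulgI (one_plus_eps 0)); rewrite -one_plus_epsD addr0 mulg1.
  have form0 : muq X 0 = 0.
    by apply: (addrI (muq X 0)); rewrite -(form_DrE mu_Fq) !addr0.
  have phi0 : phi 0%R = 1 := lin_char1 phi_lin.
  by rewrite -ope0 sK form0 phi0 mulr1.
(* Write x as the lift of red x times 1 + eps Y. The lift is fixed, as red x commutes with X and
   thus with the polynomial c in X. The second factor acts by the scalar phi (muq X Y), unchanged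
   because c fixes X. *)
have sJ x : 'chi_s (gl_conj c x) = 'chi_s x.
  have [Tx|Tx] := boolP (x \in T); last by rewrite !cfun0 ?TJ.
  have [Y xE] := lift_one_plus_eps x.
  have TY Z : one_plus_eps Z \in T.
    exact: (subsetP (normal_sub nsKT)) (one_plus_eps_in Z).
  have Tl : SL2_lift (red x) \in T.
    by rewrite -(groupMr _ (TY Y)) -xE.
  have cl : gl_conj c (SL2_lift (red x)) = SL2_lift (red x).
    apply: val_inj; rewrite /= gl_conjE // -!map_mxM; congr (map_mx _ _).
    by rewrite c_comm ?mulmxK // -TE.
  have norm_s Z : `|'chi_s (one_plus_eps Z)| = 'chi_s 1%g.
    rewrite sK normrM normC_lin_char // ?inE // mulr1 -s1 ger0_norm //.
    exact/ltW/irr1_gt0.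
  apply: (mulIf (irr1_neq0 s)); rewrite {1 2}xE gl_conjM // cl.
  rewrite gl_conj_one_plus_eps // !char_mul_norm1 ?irr_char //.
  rewrite !sK; congr (_ * (_ * phi _)).
  by rewrite -{1}GLAdX (form_GLAd mu_inv mu_Fq).
(* The induction formula is invariant under the substitution of c y c^-1 for y. *)
rewrite chi_i !cfIndE ?subsetT //; congr (_ * _).
rewrite (reindex_inj (can_inj (gl_conjK uc))) /=.
apply: eq_big => [y|y _]; first by rewrite !inE.
have gl_conj_cfJ : (gl_conj c g ^ gl_conj c y)%g = gl_conj c (g ^ y)%g.
  by apply: (mulgI (gl_conj c y)); rewrite -conjgC -!gl_conjM // -conjgC.
by rewrite gl_conj_cfJ sJ.
Qed.

(** Choose a = x + y X with det a = det c. Then c = a s with s in SL2; conjugation by a is covered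
    by the previous lemma, and conjugation by s is inner. *)
Lemma orbit_irr_gl_invariant (i : Iirr G) X c g :
  \det X != 0 -> X \in orbit_of muq phi 'chi_i ->
  c \in unitmx -> 'chi_i (gl_conj c g) = 'chi_i g.
Proof.
move=> dX RX uc.
have [x [y xy]] := norm_form_surj (\det c) dX.
have trX : \tr X = 0 := eqP (sl2_tr X).
pose a := x%:M + y *: sl2val X.
have da : \det a = \det c.
  by rewrite det_scalar_add22 trX mulr0 addr0 -xy mulrC.
have ua : a \in unitmx by rewrite unitmxE da -unitmxE.
have det_s : \det (invmx a *m c) == 1.
  by rewrite det_mulmx det_inv da mulVr // -unitmxE.
pose s := MkSL2 det_s.
have -> : c = a *m s by rewrite mulKVmx.
rewrite gl_conj_mul ?SL2_unitmx // orbit_irr_gl_invariant_comm //.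
by rewrite gl_conj_SL2 cfunJ ?inE.
Qed.

(** * Nilpotent orbits and the central element -1 *)

Lemma nilpotent_commutant_det (X M : 'M[Fq]_2) : 2%:R != 0 :> Fq ->
  \tr X = 0 -> \det X = 0 -> X != 0 -> M *m X = X *m M ->
  exists s, \det M = s ^+ 2.
Proof.
move=> nz2 trX dX X0 /(commutant_traceless nz2 trX X0)[ab ->]; exists ab.1.
by rewrite det_scalar_add22 trX dX !mulr0 !addr0.
Qed.

Lemma opp1_subproof : \det (- 1%:M : 'M[Fq[eps]]_2) == 1.
Proof. by rewrite det_mx22 !mxE /= oppr0 mulr0 subr0 mulrNN mulr1. Qed.
Definition SL2_opp1 : GF := MkSL2 opp1_subproof.

Lemma SL2_opp1_center : SL2_opp1 \in 'Z(G)%g.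
Proof.
apply/centerP; split=> [|x _]; first by rewrite inE.
by apply: val_inj; rewrite /= mulmxN mulNmx mulmx1 mul1mx.
Qed.

Lemma gl_conj_opp1 c : c \in unitmx -> gl_conj c SL2_opp1 = SL2_opp1.
Proof.
move=> uc; apply: val_inj; rewrite /= gl_conjE // mulmxN mulNmx mulmx1.
by rewrite (const_mx_epsV uc).1.
Qed.

Lemma tr_red_opp1 Y : \tr (red (one_plus_eps Y * SL2_opp1)%g) = - 2%:R.
Proof.
rewrite redM red_one_plus_eps mul1g mxtrace22 /= !mxE /eps0.
by rewrite !coef_dualN !coef_dual1 -opprD.
Qed.

(** By invariance, the characters of X and of c^-1 X c have equal multiplicity in the restriction,
    so Clifford makes them conjugate: c^-1 X c = s X s^-1 for some s in SL2. *)
Lemma orbit_irr_conjugate (i : Iirr G) X c : c \in unitmx ->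
  (forall Y, 'chi_i (one_plus_eps (GLAd c Y)) = 'chi_i (one_plus_eps Y)) ->
  X \in orbit_of muq phi 'chi_i ->
  exists s : SL2 Fq, (c *m s) *m X = X *m (c *m s).
Proof.
move=> uc RJ /mem_orbit_of[j ij jX]; have nsKG := cong_ker_normal Fq.
have ucV : invmx c \in unitmx by rewrite unitmx_inv.
pose X' := GLAd (invmx c) X.
have [j' j'E] : exists j', 'chi_j' = orbit_char X'.
  by have /irrP[j' ->] := lin_char_irr (orbit_char_lin X'); exists j'.
have resE Y : 'Res[K] 'chi_i (one_plus_eps Y) = 'chi_i (one_plus_eps Y).
  exact: (cfResE _ (normal_sub nsKG) (one_plus_eps_in Y)).
have e : '['Res[K] 'chi_i, 'chi_j'] = '['Res[K] 'chi_i, 'chi_j].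
  rewrite !cfdotE; congr (_ * _); rewrite !big_cong_ker.
  have GLcanV : cancel (GLAd (invmx c)) (GLAd c).
    by move: (GLAdK ucV); rewrite invmxK.
  rewrite [RHS](reindex_inj (can_inj (GLAdK uc))) /=; apply: eq_bigr => Y _.
  rewrite !resE RJ jX j'E !orbit_charE.
  by rewrite -{1}(GLcanV X) (form_GLAd mu_inv mu_Fq).
(* Otherwise ['chi_j'] is orthogonal to the whole restriction, a multiple of the sum over the class
   of ['chi_j]. *)
have j'_class : 'chi_j' \in ('chi_j ^: G)%CF.
  apply: contraTT ij => nj'; rewrite irr_consttE negbK -e.
  have [ij|] := boolP (j \in irr_constt ('Res[K] 'chi_i)); last first.
    by rewrite irr_consttE negbK e.
  rewrite (Clifford_Res_sum_cfclass nsKG ij) cfdotZl reindex_cfclass //.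
  rewrite cfdot_suml big1 ?mulr0 // => l jl; rewrite cfdot_irr; case: eqP => // lj'.
  by rewrite -lj' jl in nj'.
have /cfclassP[y _ ejy] := j'_class.
have XE : X' = Ad (red y)^-1%g X.
  by apply: orbit_char_inj => Y; rewrite -orbit_charE -j'E ejy jX orbit_char_conj.
set s := (red y)^-1%g in XE; exists s.
have {}XE : invmx c *m X *m c = s *m X *m invmx s.
  by rewrite -GLAdE ?SL2_unitmx // -Ad_GLAd -XE GLAdE // invmxK.
have := congr1 (fun M => c *m M *m s) XE.
by rewrite !mulmxA mulmxV // mul1mx mulmxKV ?SL2_unitmx // => ->.
Qed.

Lemma nilpotent_orbit_not_Sh_invariant (i : Iirr G) X : 2%:R != 0 :> Fq ->
  X != 0 -> \det X = 0 -> X \in orbit_of muq phi 'chi_i ->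
  Sh_G iota 'chi_i <> 'chi_i.
Proof.
move=> nz2 X0 dX RX ShR; have [d [d0 nsq ShE]] := Sh_G_gl_conj iota (- 2%:R) nz2.
have uc := diag2_unit d0; set c := diag2 d in uc ShE.
(* The central element -1 acts by a scalar, so the values at 1 + eps Y can be recovered from those
   at -(1 + eps Y), which has trace -2 modulo eps. *)
have inv_opp1 : `|'chi_i SL2_opp1| = 'chi_i 1%g.
  apply/eqP; rewrite -irr_cfcenterE ?inE //.
  have := SL2_opp1_center; rewrite -cap_cfcenter_irr => /bigcapP; exact.
have nz_opp1 : 'chi_i SL2_opp1 != 0.
  by rewrite -normr_eq0 inv_opp1 irr1_neq0.
have mul_opp1 Y : 'chi_i (one_plus_eps Y) * 'chi_i SL2_opp1 =
    'chi_i (one_plus_eps Y * SL2_opp1)%g * 'chi_i 1%g.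
  by rewrite char_mul_norm1 ?irr_char ?inE.
have [Y|s csX] := orbit_irr_conjugate uc _ RX.
  apply: (mulIf nz_opp1); rewrite !mul_opp1; congr (_ * _).
  rewrite -gl_conj_one_plus_eps // -{1}(gl_conj_opp1 uc) -gl_conjM //.
  by rewrite -ShE ?tr_red_opp1 // ShR.
(* The product c s centralizes X, so its determinant d would be a square. *)
have [r] := nilpotent_commutant_det nz2 (eqP (sl2_tr X)) dX X0 csX.
rewrite det_mulmx (eqP (SL2_det s)) mulr1 det_diag2 => dr.
by have := nsq (erefl _) r; rewrite dr eqxx.
Qed.
End OrbitCharacters.

Theorem corollary5p1 (p : nat) (Fq : finFieldType)
    (charFq : p \in [pchar Fq]) (p_odd : odd p)
    (k : closedFieldType) (iota : {rmorphism Fq -> k})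
    (k_alg : integralRange iota)
    (mu : {biscalar sl2 k}) (mu_nondeg : nondegenerate_form mu)
    (mu_inv : SL2_invariant mu)
    (muq : sl2 Fq -> sl2 Fq -> Fq) (mu_Fq : defined_over iota mu muq)
    (phi : 'CF([set: Fq])) (phi_lin : phi \is a linear_char) (phi_nt : phi != 1)
    (R : 'CF([set: SL2 Fq[eps]])) (R_irr : R \in irr [set: SL2 Fq[eps]])
    (R_prim : primitive_char R) :
  semisimple_orbit_char muq phi iota R <-> Sh_G iota R = R.
Proof.
have nz2 : 2%:R != 0 :> Fq.
  rewrite -(dvdn_pcharf charFq) dvdn_prime2 ?(pcharf_prime charFq) //.
  by apply: contraTneq p_odd => ->.
have /irrP[i iE] := R_irr; move: R_prim; rewrite iE => prim.
have X_neq0 X : X \in orbit_of muq phi 'chi_i -> sl2val X != 0.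
  move=> RX; have := primitive_orbit_neq0 mu_Fq phi_lin prim RX.
  by apply: contraNneq => X0; apply/eqP/val_inj.
have diagE X : X \in orbit_of muq phi 'chi_i ->
    diagonalizable (map_mx iota X) <-> \det X != 0.
  by move=> /X_neq0; apply: diagonalizable_traceless => //; apply/eqP/sl2_tr.
split=> [ss|ShR X RX].
  have [X RX] := orbit_of_nonempty mu_nondeg mu_Fq phi_lin phi_nt i.
  have dX : \det X != 0 by apply/(diagE _ RX)/ss.
  apply/cfun_inP => g _.
  (* Here d varies with the trace of g, but invariance under all of GL2 covers every d. *)
  have [d [d0 _ ->//]] := Sh_G_gl_conj iota (\tr (red g)) nz2.
  exact: (orbit_irr_gl_invariant mu_nondeg mu_inv mu_Fq phi_lin phi_nt
    g dX RX (diag2_unit d0)).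
apply/(diagE _ RX)/eqP => dX.
exact: (nilpotent_orbit_not_Sh_invariant mu_nondeg mu_inv mu_Fq phi_lin phi_nt
  nz2 (X_neq0 _ RX) dX RX ShR).
Qed.
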